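(* Consider the Hawkes processes started empty at time $0$ with kernel shape $g(t)=\gamma(1+t)^{-1-\gamma}$, $\gamma\in(1/2,1)$, baseline $\mu_T=\mu^*T^{\gamma-1}$ and branching ratio $\rho_T=1-\lambda^*T^{-\gamma}$, with $g$ and $\rho_T$ known. For $M,H>0$ let $W=[MT,(M+H)T]$, $Q_T^W=\mu_T^2\int_W\lambda_T(t)^{-1}\,\mathrm dt$, and let $\hat\mu_T^W$ be the maximum likelihood estimator of $\mu_T$ on the window $W$ conditionally on the past. Then for every $K>0$ $$\lim_{H\to\infty}\liminf_{M\to\infty}\liminf_{T\to\infty}\mathbb P\big(Q_T^W\ge K\big)=1$$ and $$\lim_{H\to\infty}\limsup_{M\to\infty}\limsup_{T\to\infty}\mathbb P\big(|\hat\mu_T^W/\mu_T-1|>\varepsilon_\mu\big)=0\qquad\text{for every }\varepsilon_\mu>0.$$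
   Context: Fix $\lambda^*,\mu^*>0$; $T$ is large enough that $\rho_T\in(0,1)$. $N$ is the linear Hawkes process started empty at time $0$: a simple point process on $(0,\infty)$ with points $t_1<t_2<\cdots$ and stochastic intensity $\lambda_T(t)=\mu_T+\rho_T\sum_{t_j<t}g(t-t_j)$. The interval $[0,MT]$ is a burn-in that enters the intensity but not the likelihood: $\hat\mu_T^W$ maximises $\ell_T^W(m)=\sum_{t_i\in W}\log(m+E_i)-mHT$ over $m\ge0$, where $E_i=\rho_T\sum_{j<i}g(t_i-t_j)$ (all earlier points included, $\log0=-\infty$); the maximiser may be $0$. *)

(* Defs.v *)
From HB Require Import structures.
From mathcomp Require Import all_boot all_order all_algebra.
From mathcomp Require Import all_classical all_reals all_analysis.
From mathcomp Require Import measurable_realfun.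

Set Implicit Arguments.
Unset Strict Implicit.
Unset Printing Implicit Defensive.

Import Order.TTheory GRing.Theory Num.Theory.
Import numFieldNormedType.Exports.

Local Open Scope classical_set_scope.
Local Open Scope ring_scope.

Definition hawkes_kernel (R : realType) (gamma t : R) : R :=
  gamma * (1 + t) `^ (- 1 - gamma).

Definition baseline (R : realType) (mustar gamma T : R) : R :=
  mustar * T `^ (gamma - 1).

Definition branching (R : realType) (lamstar gamma T : R) : R :=
  1 - lamstar * T `^ (- gamma).

Section PointProcess.
Context (d : measure_display) (Omega : measurableType d) (R : realType).
Implicit Types (t : nat -> Omega -> \bar R) (lam : R -> Omega -> R).

(* [t n w] is the point of index [n] (indices start at 0); the value [+oo]
   means that the configuration [w] has at most [n] points. Divergence of
   the points is local finiteness. *)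
Definition simple_point_process t : Prop :=
  [/\ forall n, measurable_fun setT (t n),
      forall n w, (0 < t n w)%E,
      forall n w, (t n w < +oo -> t n w < t n.+1 w)%E,
      forall n w, t n w = +oo%E -> t n.+1 w = +oo%E
    & forall w, t ^~ w @ \oo --> +oo%E ].

(* Internal history at time [s]: [[set w | t n w <= u]] is the event
   [N_u >= n + 1], so this is the sigma-algebra of [(N_u)_(u <= s)]. *)
Definition history t (s : R) : set (set Omega) :=
  <<s [set A | exists n u, u <= s /\ A = [set w | (t n w <= u%:E)%E]] >>.

Definition predictable_sets t : set (set (Omega * R)) :=
  <<s setT `*` `]0, +oo[,
      [set B | exists A a b, [/\ history t a A, 0 <= a, a <= b
                              & B = A `*` `]a, b]] ] >>.

Definition predictable t (C : Omega * R -> R) : Prop :=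
  forall Y : set R, measurable Y ->
    predictable_sets t ((setT `*` `]0, +oo[) `&` C @^-1` Y).

(* [E (\int C dN) = E (\int C_s lam_s ds)] for every nonnegative predictable
   [C]; a point at [+oo] contributes nothing to the left-hand side. *)
Definition stochastic_intensity (P : probability Omega R) t lam : Prop :=
  forall C : Omega * R -> R, predictable t C -> (forall z, 0 <= C z) ->
    (\int[P]_w (\sum_(0 <= n <oo)
                  if t n w is r%:E then (C (w, r))%:E else 0) =
     \int[P]_w (\int[lebesgue_measure]_(s in `]0%R, +oo[)
                  (C (w, s) * lam s w)%:E))%E.

End PointProcess.

Section Hawkes.
Context (d : measure_display) (Omega : measurableType d) (R : realType).
Implicit Types (t : nat -> Omega -> \bar R) (g : R -> R).

(* The sums over [i \in A] in this section have finite index sets as soon as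
   the points diverge. *)
Definition hawkes_intensity (mu rho : R) g t (s : R) (w : Omega) : R :=
  mu + rho * \sum_(j \in [set j | (t j w < s%:E)%E]) g (s - fine (t j w)).

Definition linear_hawkes (P : probability Omega R) (mu rho : R) g t : Prop :=
  simple_point_process t /\
  stochastic_intensity P t (hawkes_intensity mu rho g t).

Definition excitation (rho : R) g t (i : nat) (w : Omega) : R :=
  rho * \sum_(0 <= j < i) g (fine (t i w) - fine (t j w)).

(* Log-likelihood on the window [[a, b]], conditionally on the past, without
   the terms that do not depend on [m]; [lne] is [-oo] at 0. *)
Definition log_likelihood (rho : R) g t (a b : R) (w : Omega) (m : R) : \bar R :=
  (\sum_(i \in [set i | a%:E <= t i w <= b%:E])
     lne (m + excitation rho g t i w)%:E - (m * (b - a))%:E)%E.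

Definition is_mle (rho : R) g t (a b : R) (w : Omega) (m : R) : Prop :=
  0 <= m /\
  forall m', 0 <= m' ->
    (log_likelihood rho g t a b w m' <= log_likelihood rho g t a b w m)%E.

Definition baseline_information (mu rho : R) g t (a b : R) (w : Omega) : R :=
  mu ^+ 2 * \int[lebesgue_measure]_(s in `[a, b])
              (hawkes_intensity mu rho g t s w)^-1.

End Hawkes.

(* Main.v *)
Require Import Defs.
From HB Require Import structures.
From mathcomp Require Import all_boot all_order all_algebra.
From mathcomp Require Import all_classical all_reals all_analysis.
From mathcomp Require Import measurable_realfun.
From mathcomp Require Import ring lra.

Set Implicit Arguments.
Unset Strict Implicit.
Unset Printing Implicit Defensive.

Import Order.TTheory GRing.Theory Num.Theory.
Import numFieldNormedType.Exports.

Local Open Scope classical_set_scope.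
Local Open Scope ring_scope.

(** Write [mu] and [rho] for the baseline and the branching ratio, [lambda] for
    the intensity, [[a, b]] for the window, of length [L = b - a], [Q] for the
    information [mu ^ 2 * int 1 / lambda] over the window and [ell] for the
    log-likelihood. Both limits follow from two inequalities that hold for every
    fixed scale and every burn-in; only the scaling identity
    [mu * (1 - rho) * L = mustar * lamstar * H] then connects them to [H].

    Information is large. Every point has at most [rho] children on average, so
    [E lambda <= mu / (1 - rho)] at all times ([mean_intensity_le]). By convexity
    of the inverse, [Q] can be smaller than [K] only if the integral of
    [lambda] over the window is at least [mu ^ 2 * L ^ 2 / K], and Markov's
    inequality gives [P (Q < K) <= K / (mu * (1 - rho) * L)]
    ([proba_information_lt]).

    The estimator is accurate. As the log-likelihood is strictly concave, a
    maximiser further than [e * mu] from [mu] forces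
    [ell mu < ell (mu + v)] with [v = e * mu] or [v = - e * mu] ([mle_gt],
    [mle_lt]). The square root of the likelihood ratio between [mu + v] and [mu],
    corrected by its compensator, is the stochastic exponential
    [exp_martingale], whose expectation is 1 ([expectation_exp_martingale]). The
    correction is a Hellinger distance between the two intensities, and it is
    bounded below by a multiple of the information: on the event
    [ell mu < ell (mu + v)] the martingale is at least
    [exp (v ^ 2 / mu ^ 2 / 18 * Q)] ([exp_martingale_ge]). Hence this event has
    probability at most [exp (- e ^ 2 / 18 * K)] on [K <= Q]
    ([proba_likelihood_exceeds]). The compensation makes this work for an
    information that stays random in the limit: only a lower bound on [Q] enters.
    With [K] the square root of [H] both error terms are of order [1 / sqrt H].

    Two technical points carry the probabilistic part. The intensity is only
    known through the identity between sums over points and integrals against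
    [lambda] for predictable integrands, so each integrand has to be shown
    predictable: this is done by writing it as a measurable function of the time
    and of the points stopped at that time ([measurable_stopped_point]). And the
    estimator is an arbitrary selection of maximisers; its measurability comes
    from uniqueness, again through strict concavity ([measurable_mle]). *)

(** * The predictable sigma-algebra *)

Section Predictability.
Context (d : measure_display) (Omega : measurableType d) (R : realType).
Variable t : nat -> Omega -> \bar R.
Hypothesis spp : simple_point_process t.

Definition predictable_rectangles : set (set (Omega * R)) :=
  [set B | exists A a b, [/\ history t a A, 0 <= a, a <= b
                              & B = A `*` `]a, b]] ].

(** The predictable sigma-algebra on all of [Omega * R] instead of its positive
    half: predictability becomes measurability of a total function. *)
Definition predictableType := g_sigma_algebraType predictable_rectangles.

(** The sets whose trace on positive times is predictable form a sigma-algebra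
    that contains the generating rectangles. *)
Lemma measurable_predictable (C : predictableType -> R) :
  measurable_fun setT C -> predictable t C.
Proof.
move=> mC Y mY; have := mC measurableT Y mY; rewrite setTI.
pose D : set (Omega * R) := setT `*` `]0, +oo[.
suff : <<s predictable_rectangles >> `<=`
    [set B | predictable_sets t (D `&` B)] by move=> /[apply].
apply: smallest_sub; last first.
  move=> B [A [a [b [hA a0 ab ->]]]] /=.
  apply: sub_sigma_algebra; exists A, a, b; split => //.
  apply/seteqP; split=> [[w s] [_]//|[w s] [/= Aw sab]]; split => //; split => //=.
  by move: sab; rewrite /= !in_itv/= andbT => /andP[as_ _]; exact: le_lt_trans as_.
have sD : sigma_algebra D (predictable_sets t) by exact: smallest_sigma_algebra.
case: sD => s0 sC sU; split => [|A /= sA|F /= sF].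
- by rewrite /= setI0.
- rewrite (_ : D `&` _ = D `\` (D `&` A)); first exact: sC.
  by rewrite setDIr setDv set0U setTD setDE.
- by rewrite /= setI_bigcupr; exact: sU.
Qed.

(** Stopping the points at the current time keeps exactly what is known strictly
    before that time: a point still to come only shows the value of the clock.
    Clamping the clock at 0 makes it constant on negative times, where the
    rectangles separate nothing. *)
Definition stopped_point (z : Omega * R) (j : nat) : R :=
  fine (mine (t j z.1) (Num.max 0 z.2)%:E).

Lemma stopped_pointE z j : (stopped_point z j)%:E = mine (t j z.1) (Num.max 0 z.2)%:E.
Proof.
case: spp => _ t0 _ _ _; rewrite fineK//.
rewrite fin_numElt; apply/andP; split; last by rewrite gt_min ltry orbT.
by rewrite lt_min ltNyr andbT (lt_trans _ (t0 _ _))// ltNyr.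
Qed.

Lemma lt_stopped_point z j c :
  (c < stopped_point z j) = (c%:E < t j z.1)%E && (c < Num.max 0 z.2).
Proof. by rewrite -lte_fin stopped_pointE lt_min lte_fin. Qed.

Lemma history_le j (c : R) : history t c [set w | (t j w <= c%:E)%E].
Proof. by apply: sub_sigma_algebra; exists j, c. Qed.

Lemma history_setT (c : R) : history t c setT.
Proof. by rewrite -[setT]setC0; apply: sigma_algebraC; exact: sigma_algebra0. Qed.

Lemma predictable_slab (A : set Omega) (c : R) : 0 <= c -> history t c A ->
  measurable (A `*` `]c, +oo[ : set predictableType).
Proof.
move=> c0 hA.
rewrite (_ : _ `*` _ = \bigcup_k (A `*` `]c, c + k%:R])).
  apply: bigcup_measurable => k _; apply: sub_sigma_algebra.
  by exists A, c, (c + k%:R); split => //; rewrite lerDl.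
apply/seteqP; split => [[w s] [/= Aw]|[w s] [k _ [/= Aw]]]; rewrite /= !in_itv/=.
  rewrite andbT => cs; exists (Num.truncn (s - c)).+1 => //; split => //=.
  by rewrite in_itv/= cs -lerBlDl ltW// truncnS_gt// subr_ge0 ltW.
by rewrite andbT => /andP[].
Qed.

Lemma measurable_time :
  measurable_fun setT (fun z : predictableType => Num.max 0 z.2 : R).
Proof.
apply: (measurability _ (RGenOInfty.measurableE R)) => _ [_ [c ->] <-].
rewrite setTI; have [c0|c0] := leP 0 c.
  rewrite (_ : _ @^-1` _ = setT `*` `]c, +oo[).
    exact: (predictable_slab c0 (@history_setT c)).
  apply/seteqP; split=> [[w s]|[w s] [_]] /=; rewrite /= !in_itv/= !andbT lt_max.
    by rewrite ltNge c0.
  by move=> ->; rewrite orbT.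
rewrite (_ : _ @^-1` _ = setT)//.
by apply/seteqP; split => // -[w s] _ /=; rewrite in_itv/= andbT lt_max c0.
Qed.

(** A stopped point exceeds [c >= 0] when the clock and the point both do, and
    whether the point does is known at time [c]. *)
Lemma measurable_stopped_point j :
  measurable_fun setT (fun z : predictableType => stopped_point z j).
Proof.
case: (spp) => _ t0 _ _ _.
apply: (measurability _ (RGenOInfty.measurableE R)) => _ [_ [c ->] <-].
rewrite setTI; have [c0|c0] := leP 0 c.
  rewrite (_ : _ @^-1` _ =
      (setT `*` `]c, +oo[) `\` ([set w | (t j w <= c%:E)%E] `*` `]c, +oo[)).
    apply: measurableD; first exact: (predictable_slab c0 (@history_setT c)).
    exact: (predictable_slab c0 (@history_le j c)).
  apply/seteqP; split=> [[w s]|[w s]] /=; rewrite !in_itv/= !andbT lt_stopped_point/=.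
    rewrite lt_max (ltNge c) c0/= => /andP[ct cs].
    by split => // -[]; rewrite leNgt ct.
  move=> [[_ cs] /not_andP[/negP|//]]; rewrite -ltNge => ct.
  by rewrite ct lt_max cs orbT.
rewrite (_ : _ @^-1` _ = setT)//.
apply/seteqP; split => // -[w s] _ /=; rewrite in_itv/= andbT lt_stopped_point.
by rewrite (lt_trans _ (t0 _ _)) ?lte_fin//= lt_max c0.
Qed.

(** Histories consist of events, so that predictable sets are jointly
    measurable. *)
Lemma measurable_predictableType_id :
  measurable_fun [set: Omega * R] (fun z => z : predictableType).
Proof.
move=> _ B; rewrite setTI preimage_id.
suff : <<s predictable_rectangles >> `<=` [set B | measurable B] by exact.
apply: smallest_sub; first exact: sigma_algebra_measurable.
move=> _ [A [a [b [hA _ _ ->]]]] /=; apply: measurableX => //.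
suff : history t a `<=` measurable by exact.
apply: smallest_sub; first exact: sigma_algebra_measurable.
move=> _ [n [u [_ ->]]]; case: (spp) => mt _ _ _ _.
by rewrite -[X in measurable X]setTI; exact: emeasurable_fun_infty_c.
Qed.

Lemma measurable_predictableT (C : predictableType -> R) :
  measurable_fun setT C -> measurable_fun [set: Omega * R] C.
Proof. by move=> mC; exact: measurableT_comp measurable_predictableType_id. Qed.

End Predictability.

(** * Points and intensity *)

Lemma fsbig_nat (V : Type) (idx : V) (op : Monoid.com_law idx) (n : nat)
    (p : pred nat) (F : nat -> V) :
  (forall i, p i -> (i < n)%N) ->
  \big[op/idx]_(i \in [set j | p j]) F i = \big[op/idx]_(0 <= i < n | p i) F i.
Proof.
move=> pn; rewrite (@bigfs _ _ _ _ (index_iota 0 n) p)//; first exact: iota_uniq.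
by move=> i /pn; rewrite mem_index_iota => ->.
Qed.

Section Points.
Context (d : measure_display) (Omega : measurableType d) (R : realType).
Variable t : nat -> Omega -> \bar R.
Hypothesis spp : simple_point_process t.

Lemma point_gt0 n w : (0 < t n w)%E. Proof. by case: spp. Qed.

Lemma point_lt w i j : (i < j)%N -> (t i w < +oo)%E -> (t i w < t j w)%E.
Proof.
case: spp => _ _ tS tinfty _; elim: j => // j IH; rewrite ltnS leq_eqVlt.
move=> /predU1P[->|ij]; first exact: tS.
move=> ti; have tij := IH ij ti; have [tj|] := ltP (t j w) +oo%E.
  exact: lt_trans tij (tS _ _ tj).
by rewrite leye_eq => /eqP tj; rewrite (tinfty _ _ tj).
Qed.

Lemma point_le w i j : (i <= j)%N -> (t i w <= t j w)%E.
Proof.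
rewrite leq_eqVlt => /predU1P[->//|ij]; have [ti|] := ltP (t i w) +oo%E.
  exact/ltW/point_lt.
case: spp => _ _ _ tinfty _; rewrite leye_eq => /eqP ti.
elim: j ij => // j IH; rewrite ltnS leq_eqVlt => /predU1P[<-|/IH tj].
  by rewrite (tinfty _ _ ti) leey.
by rewrite tinfty ?leey//; apply/eqP; rewrite -leye_eq -ti.
Qed.

Lemma point_gt w (b : R) : exists n, (b%:E < t n w)%E.
Proof.
case: spp => _ _ _ _ /(_ w) /cvgey_gtr /(_ b (num_real _)).
by move=> [n _ /(_ n (leqnn n))]; exists n.
Qed.

Lemma lt_point_index w (s : R) n i : (s%:E <= t n w)%E -> (t i w < s%:E)%E -> (i < n)%N.
Proof.
move=> sn; apply: contraTT; rewrite -leqNgt -leNgt => ni.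
exact: le_trans sn (point_le _ ni).
Qed.

Lemma stopped_point_lt z j u : u <= z.2 ->
  (stopped_point t z j < u) = (t j z.1 < u%:E)%E.
Proof.
move=> uz; rewrite -lte_fin stopped_pointE// gt_min lte_fin.
by rewrite [X in _ || X]ltNge le_max uz orbT orbF.
Qed.

Lemma stopped_point_id z j : (t j z.1 <= z.2%:E)%E ->
  stopped_point t z j = fine (t j z.1).
Proof.
move=> tz; congr fine; apply/min_idPl; rewrite (le_trans tz)// lee_fin.
by rewrite le_max lexx orbT.
Qed.

Lemma measurable_stopped_pointT j : measurable_fun setT (stopped_point t ^~ j).
Proof. exact: measurable_predictableT spp _ (measurable_stopped_point spp j). Qed.

End Points.

(** Evaluated at stopped points, this explicit function of finitely many real
    arguments gives a predictable version of the intensity. *)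
Definition intensity_trunc (R : realType) (mu rho : R) (g : R -> R) (n : nat)
    (x : nat -> R) (u : R) : R :=
  mu + rho * \sum_(0 <= j < n | x j < u) g (u - x j).

Section Intensity.
Context (d : measure_display) (Omega : measurableType d) (R : realType).
Variables (t : nat -> Omega -> \bar R) (mu rho : R) (g : R -> R).
Hypothesis spp : simple_point_process t.
Hypothesis mg : measurable_fun setT g.
Hypotheses (mu_gt0 : 0 < mu) (rho_ge0 : 0 <= rho).
Hypothesis g_ge0 : forall s : R, 0 <= s -> 0 <= g s.

Let lam := hawkes_intensity mu rho g t.
Let lamn := intensity_trunc mu rho g.

(** The points that excite the intensity at [u] have index less than [n] because
    [u <= t_n], and stopping at [s >= u] leaves them unchanged. *)
Lemma hawkes_intensity_trunc n w u s : (u%:E <= t n w)%E -> u <= s ->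
  lam u w = lamn n (stopped_point t (w, s)) u.
Proof.
move=> un us; rewrite /lam /lamn /hawkes_intensity /intensity_trunc.
rewrite (@fsbig_nat _ _ _ n (fun j => (t j w < u%:E)%E)); last first.
  by move=> i; exact: (lt_point_index spp un).
congr (_ + _ * _); rewrite [LHS]big_mkcond [RHS]big_mkcond/=.
apply: eq_bigr => i _; rewrite stopped_point_lt//; case: ifPn => // tiu.
by rewrite stopped_point_id//= (le_trans (ltW tiu))// lee_fin.
Qed.

Lemma hawkes_intensity_point i w : (t i w < +oo)%E ->
  lam (fine (t i w)) w = mu + excitation rho g t i w.
Proof.
move=> tioo; have tifin : (fine (t i w))%:E = t i w.
  by rewrite fineK// fin_numElt tioo (lt_trans _ (point_gt0 spp _ _)).
rewrite /lam /hawkes_intensity /excitation.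
rewrite (@fsbig_nat _ _ _ i (fun j => (t j w < (fine (t i w))%:E)%E)); last first.
  by move=> j; apply: (lt_point_index spp); rewrite tifin.
congr (_ + _ * _); rewrite big_mkcond/=; apply: eq_big_nat => j /andP[_ ji].
rewrite tifin point_lt// (le_lt_trans _ tioo)//; apply: point_le => //.
exact: ltnW.
Qed.

Lemma intensity_trunc_ge n x u : mu <= lamn n x u.
Proof.
rewrite lerDl mulr_ge0// sumr_ge0// => j xj; apply: g_ge0.
by rewrite subr_ge0 ltW.
Qed.

Lemma hawkes_intensity_ge u w : mu <= lam u w.
Proof.
have [n un] := point_gt spp w u.
by rewrite (hawkes_intensity_trunc (ltW un) (lexx u)) intensity_trunc_ge.
Qed.

Lemma hawkes_intensity_gt0 u w : 0 < lam u w.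
Proof. exact: lt_le_trans mu_gt0 (hawkes_intensity_ge u w). Qed.

Lemma intensity_trunc_le n x u G : (forall s, 0 <= s -> g s <= G) ->
  lamn n x u <= mu + rho * (G * n%:R).
Proof.
move=> gG; have G0 : 0 <= G by rewrite (le_trans (g_ge0 (lexx 0)))// gG.
rewrite lerD2l ler_wpM2l//.
rewrite (_ : G * n%:R = \sum_(0 <= j < n) G); last first.
  by rewrite sumr_const_nat subn0 mulr_natr.
rewrite big_mkcond; apply: ler_sum => j _; case: ifPn => // xj.
by rewrite gG// subr_ge0 ltW.
Qed.

Lemma measurable_intensity_trunc d' (S : measurableType d') n
    (x : S -> nat -> R) (u : S -> R) :
  (forall j, measurable_fun setT (x ^~ j)) -> measurable_fun setT u ->
  measurable_fun setT (fun z => lamn n (x z) (u z)).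
Proof.
move=> mx mu_; apply: measurable_funD => //; apply: measurable_funM => //.
under eq_fun do rewrite big_mkcond/=.
elim: n => [|n IH]; first by under eq_fun do rewrite big_geq//; exact: measurable_cst.
under eq_fun do rewrite big_nat_recr//=.
apply: measurable_funD => //; apply: measurable_fun_ifT => //.
  exact: measurable_fun_ltr.
by apply: (measurableT_comp mg); exact: measurable_funB.
Qed.

(** Only finitely many points precede a given time, so the truncations are
    eventually equal to the intensity. *)
Lemma measurable_hawkes_intensity :
  measurable_fun [set: Omega * R] (fun z => lam z.2 z.1).
Proof.
apply: (@measurable_fun_cvg _ _ _ _
  (fun n (z : Omega * R) => lamn n (stopped_point t z) z.2)).
  by move=> n; apply: measurable_intensity_trunc => // j; exact: measurable_stopped_pointT.
move=> [w s] _ /=; apply: cvg_near_cst.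
have [n sn] := point_gt spp w s; exists n => // m /= nm.
rewrite (@hawkes_intensity_trunc m _ _ s)// ltW// (lt_le_trans sn)//.
exact: point_le.
Qed.

End Intensity.

(** * The mean of the intensity *)

Section PointSum.
Context (d : measure_display) (Omega : measurableType d) (R : realType).
Variable t : nat -> Omega -> \bar R.
Hypothesis spp : simple_point_process t.

Lemma measurable_at_point (C : Omega * R -> R) n :
  measurable_fun setT C ->
  measurable_fun setT
    (fun w => if t n w is r%:E then (C (w, r))%:E else 0 : \bar R).
Proof.
case: (spp) => mt t0 _ _ _ mC.
rewrite (_ : (fun w => _) =
    (fun w => if (t n w < +oo)%E then (C (w, fine (t n w)))%:E else 0%E)).
  apply: measurable_fun_ifT => //; first exact: measurable_fun_lte.
  apply/measurable_EFinP/(measurableT_comp mC).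
  apply: measurable_fun_pair => //.
  by apply: measurableT_comp => //; exact: mt.
apply/funext => w; have := t0 n w; case: (t n w) => [r _||//].
  by rewrite ltry.
by rewrite ltxx.
Qed.

End PointSum.

(** The first generation of a Poisson cluster has rate [mu] and each point has a
    mean number of children at most [rho], hence the bound [mu / (1 - rho)]. The
    renewal inequality behind it can be solved only for finite means, so it is
    established for the intensity cut at the [n]-th point, which is bounded, and
    [n] tends to infinity at the end. *)
Section MeanIntensity.
Context (d : measure_display) (Omega : measurableType d) (R : realType).
Variables (P : probability Omega R).
Variables (t : nat -> Omega -> \bar R) (mu rho : R) (g : R -> R).
Hypothesis spp : simple_point_process t.
Let lam := hawkes_intensity mu rho g t.
Let lamn := intensity_trunc mu rho g.
Hypothesis si : stochastic_intensity P t lam.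
Hypothesis mg : measurable_fun setT g.
Hypotheses (mu_gt0 : 0 < mu) (rho_ge0 : 0 <= rho) (rho_lt1 : rho < 1).
Hypothesis g_ge0 : forall s : R, 0 <= s -> 0 <= g s.
Variable G : R.
Hypothesis g_le : forall s : R, 0 <= s -> g s <= G.
Hypothesis g_mass : forall S : R, 0 < S ->
  (\int[lebesgue_measure]_(s in `]0%R, S[) (g (S - s))%:E <= 1)%E.

Let lam_gt0 s w : 0 < lam s w. Proof. exact: hawkes_intensity_gt0. Qed.

Let lamS (n : nat) (z : Omega * R) : R :=
  if (z.2%:E <= t n z.1)%E then lam z.2 z.1 else 0.

Let lamS_ge0 n z : 0 <= lamS n z.
Proof. by rewrite /lamS; case: ifPn => // _; exact: ltW. Qed.

Let mlamS n : measurable_fun setT (lamS n).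
Proof.
case: (spp) => mt _ _ _ _.
apply: measurable_fun_ifT => //; last exact: measurable_hawkes_intensity.
apply: measurable_fun_lee; first exact: measurableT_comp.
exact: (measurableT_comp (mt n)).
Qed.

Let kern (S s : R) : R := if (0 < s) && (s < S) then g (S - s) else 0.

Let kern_ge0 S s : 0 <= kern S s.
Proof. by rewrite /kern; case: ifPn => // /andP[_ sS]; rewrite g_ge0// subr_ge0 ltW. Qed.

Let mkern S : measurable_fun setT (kern S).
Proof.
apply: measurable_fun_ifT => //.
  by apply: measurable_and; exact: measurable_fun_ltr.
by apply: (measurableT_comp mg); exact: measurable_funB.
Qed.

Let kern_mass S : 0 < S ->
  (\int[lebesgue_measure]_s (kern S s)%:E <= 1)%E.
Proof.
move=> S0; apply: le_trans (g_mass S0); rewrite [leRHS]integral_mkcond.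
rewrite le_eqVlt; apply/orP; left; apply/eqP; apply: eq_integral => s _.
by rewrite patchE mem_setE in_itv/= /kern; case: ifPn.
Qed.

(** The kernel seen from the target time [S], up to the [n]-th point, as a
   function of the clock and of the stopped points. *)
Let C (n : nat) (S : R) (z : Omega * R) : R :=
  if (Num.max 0 z.2 < S) && ~~ (stopped_point t z n < Num.max 0 z.2)
  then g (S - Num.max 0 z.2) else 0.

Let C_ge0 n S z : 0 <= C n S z.
Proof. by rewrite /C; case: ifPn => // /andP[zS _]; rewrite g_ge0// subr_ge0 ltW. Qed.

Let mC n S : measurable_fun setT (C n S : predictableType t -> R).
Proof.
have mtau := @measurable_time _ _ _ t.
apply: measurable_fun_ifT => //.
  apply: measurable_and; first exact: measurable_fun_ltr.
  apply: measurable_neg; apply: measurable_fun_ltr => //.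
  exact: measurable_stopped_point.
by apply: (measurableT_comp mg); exact: measurable_funB.
Qed.

Let CE n S w s : 0 < s ->
  C n S (w, s) = if (s < S) && (s%:E <= t n w)%E then g (S - s) else 0.
Proof.
move=> s0; have -> : C n S (w, s) =
  if (s < S) && ~~ (stopped_point t (w, s) n < s) then g (S - s) else 0.
  by rewrite /C/= (max_idPr (ltW s0)).
by rewrite stopped_point_lt// -leNgt.
Qed.

Let lamS_le n S w : 0 < S ->
  ((lamS n (w, S))%:E <= mu%:E + rho%:E *
    \sum_(0 <= j <oo) (if t j w is r%:E then (C n S (w, r))%:E else 0))%E.
Proof.
move=> S0; have D0 j : (0 <= if t j w is r%:E then (C n S (w, r))%:E else 0)%E.
  by case: (t j w) => // r; rewrite lee_fin.
rewrite {1}/lamS/=; case: ifPn => [Sn|_]; last first.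
  apply: adde_ge0; first by rewrite lee_fin ltW.
  by apply: mule_ge0; [rewrite lee_fin|exact: nneseries_ge0].
rewrite /lam (hawkes_intensity_trunc _ _ _ spp Sn (lexx S)) /intensity_trunc.
rewrite EFinD EFinM leeD2l// lee_wpmul2l ?lee_fin//.
apply: le_trans (@nneseries_lim_ge _ _ xpredT 0 n (fun i _ _ => D0 i)).
rewrite big_mkcond/= -sumEFin; apply: lee_sum => j _.
have := D0 j; have := point_gt0 spp j w.
rewrite stopped_point_lt//=; case: ifPn => [tjS|//].
rewrite stopped_point_id/=; last exact: ltW.
have := point_le spp w (ltnW (lt_point_index spp Sn tjS)); move: tjS.
case: (t j w) => // r rS rn r0 _ /=.
by rewrite CE// -lte_fin rS rn.
Qed.

Let mean n s : \bar R := (\int[P]_w (lamS n (w, s))%:E)%E.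

Let mean_ge0 n s : (0 <= mean n s)%E.
Proof. by apply: integral_ge0 => w _; rewrite lee_fin. Qed.

Let mlamSs n s : measurable_fun setT (fun w => lamS n (w, s)).
Proof. exact: (measurableT_comp (mlamS n)). Qed.

(** Replacing the points by the intensity in the definition of the intensity
   gives the renewal inequality for the mean. *)
Let mean_step n S : 0 < S ->
  (mean n S <= mu%:E + rho%:E *
     \int[lebesgue_measure]_s ((kern S s)%:E * mean n s))%E.
Proof.
move=> S0.
pose D j w : \bar R := if t j w is r%:E then (C n S (w, r))%:E else 0.
have D0 j w : (0 <= D j w)%E.
  by rewrite /D; case: (t j w) => // r; rewrite lee_fin.
have mD j : measurable_fun setT (D j).
  exact: (measurable_at_point spp j (measurable_predictableT spp (@mC n S))).
have mDs : measurable_fun setT (fun w => \sum_(0 <= j <oo) D j w)%E.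
  exact: ge0_emeasurable_sum.
have Ds0 w : (0 <= \sum_(0 <= j <oo) D j w)%E by exact: nneseries_ge0.
apply: (@le_trans _ _ (\int[P]_w (mu%:E + rho%:E * \sum_(0 <= j <oo) D j w))%E).
  apply: ge0_le_integral => //.
  - by move=> w _; rewrite lee_fin.
  - exact/measurable_EFinP.
  - by apply: emeasurable_funD => //; exact: measurable_funeM.
  - by move=> w _; exact: lamS_le.
rewrite ge0_integralD//; last 3 first.
- by move=> w _; rewrite lee_fin ltW.
- by move=> w _; rewrite mule_ge0 ?lee_fin.
- exact: measurable_funeM.
rewrite integral_cst// [X in (_ * X)%E]probability_setT mule1.
rewrite ge0_integralZl//.
rewrite leeD2l// lee_wpmul2l ?lee_fin//.
have -> : (\int[P]_w \sum_(0 <= j <oo) D j w)%E =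
  (\int[P]_w \int[lebesgue_measure]_(s in `]0%R, +oo[)
                  (C n S (w, s) * lam s w)%:E)%E.
  by apply: si; [exact: measurable_predictable|].
have -> : (\int[P]_w \int[lebesgue_measure]_(s in `]0%R, +oo[)
                  (C n S (w, s) * lam s w)%:E)%E =
  (\int[P]_w \int[lebesgue_measure]_s ((kern S s * lamS n (w, s))%:E))%E.
  apply: eq_integral => w _; rewrite integral_mkcond; apply: eq_integral => s _.
  rewrite patchE mem_setE in_itv/= andbT /kern; case: ifPn => [s0|]; last by rewrite /= mul0r.
  rewrite CE// /lamS/=; case: (s < S) => /=; last by rewrite !mul0r.
  by case: ifPn; rewrite ?mul0r ?mulr0.
have mk : measurable_fun setT (fun z : Omega * R => (kern S z.2 * lamS n z)%:E).
  apply/measurable_EFinP; apply: measurable_funM => //.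
  exact: (measurableT_comp (mkern S)).
rewrite (fubini_tonelli (m1 := P) (m2 := lebesgue_measure)
  (fun z : Omega * R => (kern S z.2 * lamS n z)%:E))//=; last first.
  by move=> z; rewrite lee_fin mulr_ge0.
rewrite le_eqVlt; apply/orP; left; apply/eqP; apply: eq_integral => s _.
under eq_integral do rewrite EFinM.
rewrite ge0_integralZl//; first exact/measurable_EFinP.
- by move=> w _; rewrite lee_fin.
- by rewrite lee_fin.
Qed.

Let mean_le n S : 0 < S -> (mean n S <= (mu / (1 - rho))%:E)%E.
Proof.
pose A : \bar R := ereal_sup [set mean n s | s in `]0, +oo[].
have meanA s : 0 < s -> (mean n s <= A)%E.
  by move=> s0; apply: ereal_sup_ubound; exists s => //=; rewrite in_itv/= s0.
have A0 : (0 <= A)%E by apply: le_trans (meanA 1 ltr01); exact: mean_ge0.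
have AB : (A <= (mu + rho * (G * n%:R))%:E)%E.
  apply: ge_ereal_sup => _ [s /= _ <-].
  apply: (@le_trans _ _ (\int[P]_w (mu + rho * (G * n%:R))%:E)%E); last first.
    by rewrite integral_cst// [X in (_ * X)%E]probability_setT mule1.
  have B0 : 0 <= mu + rho * (G * n%:R).
    apply: addr_ge0; first exact: ltW.
    by rewrite !mulr_ge0// (le_trans (g_ge0 (lexx 0)))// g_le.
  apply: ge0_le_integral => //.
  - by move=> w _; rewrite lee_fin.
  - exact/measurable_EFinP.
  - move=> w _; rewrite lee_fin /lamS/=; case: ifPn => // sn.
    by rewrite /lam (hawkes_intensity_trunc _ _ _ spp sn (lexx s)) intensity_trunc_le.
(* The renewal inequality makes the supremum of the means a subsolution of
   [A = mu + rho * A]; finiteness of [A] then bounds it. *)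
have Astep : (A <= mu%:E + rho%:E * A)%E.
  apply: ge_ereal_sup => _ [s /= + <-]; rewrite in_itv/= andbT => s0.
  apply: le_trans (mean_step n s0) _.
  rewrite leeD2l// lee_wpmul2l ?lee_fin//.
  apply: (@le_trans _ _ (\int[lebesgue_measure]_u ((kern s u)%:E * A))%E).
    apply: ge0_le_integral => //.
    - by move=> u _; rewrite mule_ge0 ?lee_fin.
    - apply: emeasurable_funM.
        by apply/measurable_EFinP; exact: mkern.
      apply: (measurable_fun_fubini_tonelli_G (m1 := P)
        (fun z : Omega * R => (lamS n z)%:E)); first exact/measurable_EFinP.
      by move=> z; rewrite lee_fin.
    - by apply: emeasurable_funM => //; apply/measurable_EFinP; exact: mkern.
    - move=> u _; have [u0|u0] := ltP 0 u.
        by rewrite lee_wpmul2l ?lee_fin ?meanA.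
      by rewrite /kern (le_gtF u0)/= !mul0e.
  rewrite ge0_integralZr//; last by move=> u _; rewrite lee_fin.
    by rewrite -[leRHS]mul1e lee_wpmul2r// kern_mass.
  by apply/measurable_EFinP; exact: mkern.
move=> S0; apply: le_trans (meanA S S0) _.
move: A0 AB Astep; case: A {meanA} => [a|//|//] _ _.
rewrite -EFinM -EFinD !lee_fin => ha.
by rewrite ler_pdivlMr ?subr_gt0//; lra.
Qed.

Lemma mean_intensity_le S : 0 < S ->
  (\int[P]_w (lam S w)%:E <= (mu / (1 - rho))%:E)%E.
Proof.
move=> S0.
have cv : (\int[P]_w (lamS n (w, S))%:E @[n --> \oo] -->
  \int[P]_w (limn (fun n => (lamS n (w, S))%:E)))%E.
  apply: cvg_monotone_convergence => //.
  - by move=> n; exact/measurable_EFinP.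
  - by move=> n w _; rewrite lee_fin.
  - move=> w _ m n mn; rewrite lee_fin /lamS/=; case: ifPn => [Sm|_].
      by rewrite (le_trans Sm)// point_le.
    by case: ifPn => // _; exact: ltW.
have -> : (\int[P]_w (lam S w)%:E = \int[P]_w (limn (fun n => (lamS n (w, S))%:E)))%E.
  apply: eq_integral => w _; apply/esym/cvg_lim => //; apply: cvg_near_cst.
  have [n Sn] := point_gt spp w S; exists n => // m /= nm.
  by rewrite /lamS/= ifT// ltW// (lt_le_trans Sn)// point_le.
rewrite -(cvg_lim _ cv)//; apply: lime_le; first by apply/cvg_ex; eexists; exact: cv.
by apply: nearW => n; exact: mean_le.
Qed.

Lemma mean_integral_intensity_le a b : 0 < a -> a <= b ->
  (\int[P]_w \int[lebesgue_measure]_(s in `[a, b]) (lam s w)%:E <=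
   ((b - a) * (mu / (1 - rho)))%:E)%E.
Proof.
move=> a0 ab; under eq_integral do rewrite integral_mkcond.
have mk : measurable_fun setT
    (fun z : Omega * R => (EFin \o lam ^~ z.1) \_ `[a, b] z.2).
  rewrite (_ : (fun z => _) = (fun z : Omega * R =>
    if (a <= z.2) && (z.2 <= b) then (lam z.2 z.1)%:E else 0%E)); last first.
    by apply/funext => -[w s]; rewrite patchE mem_setE in_itv.
  apply: measurable_fun_ifT => //.
    by apply: measurable_and; exact: measurable_fun_ler.
  by apply/measurable_EFinP; exact: measurable_hawkes_intensity.
have k0 z : (0 <= (EFin \o lam ^~ z.1) \_ `[a, b] z.2)%E.
  by rewrite patchE; case: ifPn => // _; rewrite lee_fin ltW.
rewrite (fubini_tonelli (m1 := P) (m2 := lebesgue_measure)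
  (fun z : Omega * R => (EFin \o lam ^~ z.1) \_ `[a, b] z.2))//=.
apply: (@le_trans _ _ (\int[lebesgue_measure]_(s in `[a, b]) (mu / (1 - rho))%:E)%E).
  rewrite [leRHS]integral_mkcond; apply: ge0_le_integral => //.
  - by move=> s _; apply: integral_ge0 => w _; exact: (k0 (w, s)).
  - exact: (measurable_fun_fubini_tonelli_G (m1 := P) _ mk).
  - by apply/(measurable_restrictT _ _).1.
  - move=> s _; rewrite patchE mem_setE in_itv/=.
    under eq_integral do rewrite patchE mem_setE in_itv/=.
    case: ifPn => [/andP[as_ _]|_]; last by rewrite integral0.
    exact/mean_intensity_le/(lt_le_trans a0).
rewrite integral_cst//= lebesgue_measure_itv/= lte_fin.
rewrite -EFinD; case: ifPn => [_|]; first by rewrite -EFinM lee_fin mulrC.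
move=> _; rewrite mule0 lee_fin; apply: mulr_ge0; first by rewrite subr_ge0.
by apply: divr_ge0; rewrite ?subr_ge0; exact: ltW.
Qed.

End MeanIntensity.

(** * Primitives of continuous functions *)

Section Calculus.
Context (R : realType).
Local Notation leb := (@lebesgue_measure R).

Lemma integral_is_derive (f F : R -> R) (c e : R) : c < e ->
  {within `[c, e], continuous f} ->
  (forall x, c <= x <= e -> is_derive x 1 F (f x)) ->
  (\int[leb]_(x in `[c, e]) (f x)%:E = (F e - F c)%:E)%E.
Proof.
move=> ce cf dF; rewrite (@continuous_FTC2 _ f F c e)//.
- have cF x : c <= x <= e -> {for x, continuous F}.
    move=> /dF Fx; apply/differentiable_continuous/derivable1_diffP.
    exact: ex_derive.
  split.
  + move=> x; rewrite in_itv/= => /andP[cx xe]; have := dF x _.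
    by rewrite !ltW// => /(_ isT) Fx; exact: ex_derive.
  + by apply: cvg_at_right_filter; apply: cF; rewrite lexx ltW.
  + by apply: cvg_at_left_filter; apply: cF; rewrite lexx ltW.
- move=> x; rewrite in_itv/= => /andP[cx xe]; have := dF x _.
  by rewrite !ltW// => /(_ isT) Fx; rewrite derive1E; exact: derive_val.
Qed.

Lemma continuous_itv_integrable (f : R -> R) (c e : R) : continuous f ->
  leb.-integrable `[c, e] (EFin \o f).
Proof.
move=> cf; apply: continuous_compact_integrable; first exact: segment_compact.
exact: continuous_subspaceT.
Qed.

Lemma is_derive_integral (f : R -> R) (c x : R) : continuous f -> c < x ->
  is_derive x 1 (fun y => \int[leb]_(u in `[c, y]) f u) (f x).
Proof.
move=> cf cx.
have x1 : x < x + 1 by rewrite ltrDl.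
have [dF eF] := continuous_FTC1_closed x1 (continuous_itv_integrable c (x + 1) cf)
  cx (cf x).
apply: DeriveDef; first exact: dF.
by rewrite -derive1E; exact: eF.
Qed.

(** As [tau] is a sign, the integrand is the derivative of
    [s |-> - tau * expR (- tau * (k + int f))]. *)
Lemma integral_exp_primitive (f : R -> R) (tau k c e : R) : continuous f ->
  c <= e -> tau ^+ 2 = 1 ->
  (\int[leb]_(s in `[c, e])
     (f s * expR (- (tau * (k + \int[leb]_(u in `[c, s]) f u)))%R)%:E =
   (tau * (expR (- (tau * k)) -
      expR (- (tau * (k + \int[leb]_(u in `[c, e]) f u)))))%R%:E)%E.
Proof.
move=> cf; rewrite le_eqVlt => /predU1P[<- _|ce tau1].
  by rewrite set_itv1 integral_set1 Rintegral_set1 addr0 subrr mulr0.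
(* Moving the base point of the primitive below [c] makes it differentiable
   on the closed interval. *)
pose H s : R := \int[leb]_(u in `[c - 1, s]) f u - \int[leb]_(u in `[c - 1, c]) f u.
have HE s : c <= s -> \int[leb]_(u in `[c, s]) f u = H s.
  move=> cs; rewrite /H Rintegral_itvB ?bnd_simp//; last 2 first.
    exact: continuous_itv_integrable.
    by rewrite gerBl.
  rewrite Rintegral_itv_obnd_cbnd//.
  apply: integrableS (continuous_itv_integrable c s cf) => //.
  exact: subset_itv_oc_cc.
have dH x : c <= x -> is_derive x 1 H (f x).
  move=> cx; rewrite -[f x]subr0; apply: is_deriveB.
  by apply: is_derive_integral => //; rewrite (lt_le_trans _ cx)// ltrBlDr ltrDl.
have dF x : c <= x <= e -> is_derive x 1
    (fun s => - (tau * expR (- (tau * (k + H s)))))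
    (f x * expR (- (tau * (k + H x)))).
  move=> /andP[cx _].
  have dA (y : R) : is_derive y 1 (fun y : R => - tau * (k + y)) (- tau).
    rewrite -[X in is_derive _ _ _ X]mulr1.
    have := @is_deriveZ _ _ _ (fun y : R => k + y) (- tau) y 1 1; apply.
    rewrite -[X in is_derive _ _ _ X]add0r.
    exact: is_deriveD.
  have dB (y : R) : is_derive y 1 (fun y : R => - tau * expR (- tau * (k + y)))
     (expR (- tau * (k + y))).
    have -> : expR (- tau * (k + y)) = - tau * (expR (- tau * (k + y)) * - tau).
      by rewrite mulrCA mulrNN -expr2 tau1 mulr1.
    apply: is_deriveZ; exact: (is_derive1_comp (is_derive_expR _) (dA y)).
  rewrite mulrC; have := is_derive1_comp (dB (H x)) (dH x cx).
  by rewrite !mulNr; under [X in is_derive _ _ X _ -> _]eq_fun do rewrite /= !mulNr.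
transitivity (\int[leb]_(s in `[c, e]) (f s * expR (- (tau * (k + H s)))%R)%:E)%E.
  by apply: eq_integral => s; rewrite inE/= in_itv/= => /andP[cs _]; rewrite HE.
rewrite (integral_is_derive ce _ dF).
  have Hc : H c = 0 by rewrite /H subrr.
  by rewrite (HE e (ltW ce)) Hc addr0 opprK addrC mulrBr.
apply: continuous_in_subspaceT => x; rewrite inE/= in_itv/= => /andP[cx xe].
apply: cvgM; first exact: cf.
apply: continuous_comp; last exact: continuous_expR.
apply: cvgN; apply: cvgM; first exact: cvg_cst.
apply: cvgD; first exact: cvg_cst.
apply/differentiable_continuous/derivable1_diffP.
by have := dH x cx => ?; exact: ex_derive.
Qed.

End Calculus.

(** * The stochastic exponential *)

Lemma measurable_integral_upto d (S : measurableType d) (R : realType)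
    (f : S * R -> R) (a : R) (s : S -> R) :
  measurable_fun setT f -> (forall z, 0 <= f z) -> measurable_fun setT s ->
  measurable_fun setT
    (fun z => \int[@lebesgue_measure R]_(u in `[a, s z]) (f (z, u))%:E)%E.
Proof.
move=> mf f0 ms.
pose h (p : S * R) := (if (a <= p.2) && (p.2 <= s p.1) then f p else 0)%:E.
rewrite (_ : (fun z => _) = (fun z => \int[@lebesgue_measure R]_u h (z, u))%E).
  apply: (@measurable_fun_fubini_tonelli_F _ _ _ _ _ (@lebesgue_measure R) h).
  - apply/measurable_EFinP; apply: measurable_fun_ifT => //.
    apply: measurable_and; apply: measurable_fun_ler => //.
    exact: (measurableT_comp ms).
  - by move=> z; rewrite lee_fin; case: ifP.
apply/funext => z; rewrite integral_mkcond; apply: eq_integral => u _.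
by rewrite patchE mem_setE in_itv/= /h/=; case: ifP.
Qed.

Lemma measurable_Rintegral_upto d (S : measurableType d) (R : realType)
    (f : S * R -> R) (a : R) (s : S -> R) :
  measurable_fun setT f -> (forall z, 0 <= f z) -> measurable_fun setT s ->
  measurable_fun setT
    (fun z => \int[@lebesgue_measure R]_(u in `[a, s z]) f (z, u)).
Proof.
move=> mf f0 ms; apply: (measurableT_comp (@fine_measurable R setT measurableT)).
exact: measurable_integral_upto.
Qed.

Lemma integrable_bounded d (S : measurableType d) (R : realType)
    (P : probability S R) (f : S -> R) (B : R) :
  measurable_fun setT f -> (forall z, `|f z| <= B) ->
  P.-integrable setT (EFin \o f).
Proof.
move=> mf fB; apply: measurable_bounded_integrable => //.
  by rewrite [X in (X < _)%E]probability_setT ltry.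
by exists B; split; rewrite ?num_real// => y By z _; exact: le_trans (fB z) (ltW By).
Qed.

Lemma Rintegral_shift d (S : measurableType d) (R : realType)
    (P : probability S R) (f1 f2 h : S -> R) (k : R) :
  P.-integrable setT (EFin \o f1) -> P.-integrable setT (EFin \o f2) ->
  P.-integrable setT (EFin \o h) -> k ^+ 2 = 1 ->
  (\int[P]_w (k * (f1 w - h w))%:E = \int[P]_w (k * (f2 w - h w))%:E)%E ->
  \int[P]_w f1 w = \int[P]_w f2 w.
Proof.
move=> i1 i2 ih k1 /(congr1 fine).
rewrite -[LHS]/(\int[P]_w (k * (f1 w - h w))) -[RHS]/(\int[P]_w (k * (f2 w - h w))).
rewrite !RintegralZl//; last 2 first.
- exact: (@integrableB _ _ _ _ _ measurableT (EFin \o f2) (EFin \o h)).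
- exact: (@integrableB _ _ _ _ _ measurableT (EFin \o f1) (EFin \o h)).
rewrite !RintegralB// => /(congr1 (fun x => k * x)).
by rewrite !mulrA -expr2 k1 !mul1r => /addIr.
Qed.

(** For a nonnegative function [chi] of the intensity, the product of the values of
    [chi] at the points of the window, times the exponential of minus the
    integral of [(chi - 1) * lambda], is a stochastic exponential and has
    expectation 1. Over one step, from a point to the next, its variation is
    - the value before the step, times [chi - 1] at the new point, minus
    - the integral of the running value times [(chi - 1) * lambda],
    so that the intensity identity for one predictable integrand shows that the
    step does not change the expectation. All quantities in a step are bounded,
    which is why the induction is on the number of points and not on time.

    The intensity identity requires nonnegative integrands. Hence [chi - 1] must
    have a constant sign [tau], and [tau * (chi - 1)] is used in its place. *)
Section ExponentialMartingale.
Context (d : measure_display) (Omega : measurableType d) (R : realType).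
Variables (P : probability Omega R).
Variables (t : nat -> Omega -> \bar R) (mu rho : R) (g : R -> R).
Hypothesis spp : simple_point_process t.
Let lam := hawkes_intensity mu rho g t.
Let lamn := intensity_trunc mu rho g.
Hypothesis si : stochastic_intensity P t lam.
Hypotheses (mu_gt0 : 0 < mu) (rho_ge0 : 0 <= rho).
Hypothesis g_cont : continuous g.
Hypothesis g_ge0 : forall s : R, 0 <= g s.
Variables (a b : R).
Hypotheses (a_gt0 : 0 < a) (ab : a < b).
Variables (chi : R -> R) (tau c : R).
Hypothesis chi_cont : forall l, mu <= l -> {for l, continuous chi}.
Hypothesis mchi : measurable_fun setT chi.
Hypothesis tau1 : tau ^+ 2 = 1.
Hypothesis chi_ge0 : forall l, mu <= l -> 0 <= chi l.
Hypothesis chi_sign : forall l, mu <= l -> 0 <= tau * (chi l - 1).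
Hypothesis c_ge1 : 1 <= c.
Hypothesis chi_le : forall l, mu <= l -> chi l <= c.
Hypothesis chi_lip : forall l, mu <= l -> tau * (chi l - 1) * l <= c.

Local Notation leb := (@lebesgue_measure R).

Definition compensator_density (l : R) : R := tau * (chi l - 1) * l.
Let kap := compensator_density.

Let mg : measurable_fun setT g. Proof. exact: continuous_measurable_fun. Qed.

Let kap_ge0 l : mu <= l -> 0 <= kap l.
Proof. by move=> mul; rewrite mulr_ge0 ?chi_sign// (le_trans _ mul)// ltW. Qed.

Let mkap : measurable_fun setT kap.
Proof. by do 2 apply: measurable_funM => //; exact: measurable_funB. Qed.

Definition compensator (w : Omega) (s : R) : R :=
  \int[leb]_(u in `[a, s]) kap (lam u w).
Let J := compensator.

Definition jump_factor (n : nat) (w : Omega) : R :=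
  if (a%:E <= t n w <= b%:E)%E then chi (lam (fine (t n w)) w) else 1.

Definition jump_product (n : nat) (w : Omega) : R :=
  \prod_(0 <= j < n) jump_factor j w.

(** The [n]-th step runs from [clipped_point n] to [clipped_point n.+1]: the
    point of index [n] closes it, and the window start stands for the point
    before the first. *)
Definition clipped_point (n : nat) (w : Omega) : R :=
  if n is m.+1 then Num.max a (fine (mine (t m w) b%:E)) else a.
Let e := clipped_point.

Definition exp_martingale (n : nat) (w : Omega) : R :=
  jump_product n w * expR (- (tau * J w (e n w))).
Let Z := exp_martingale.

Let lam_ge s w : mu <= lam s w. Proof. exact: hawkes_intensity_ge. Qed.
Let lamn_ge n x u : mu <= lamn n x u. Proof. exact: intensity_trunc_ge. Qed.

Let mine_fin m w : (fine (mine (t m w) b%:E))%:E = mine (t m w) b%:E.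
Proof.
rewrite fineK// fin_numElt gt_min ltry orbT andbT lt_min ltNyr andbT.
exact: lt_trans (point_gt0 spp _ _).
Qed.

Let e_ge n w : a <= e n w.
Proof. by case: n => [|n]; rewrite /e//= le_max lexx. Qed.

Let e_le n w : e n w <= b.
Proof.
case: n => [|n]; rewrite /e/= ?ge_max ltW//=.
by rewrite -lee_fin mine_fin ge_min lexx orbT.
Qed.

Let e_nd n w : e n w <= e n.+1 w.
Proof.
case: n => [|n]; first exact: e_ge.
rewrite /e/= ge_max le_max lexx/= le_max; apply/orP; right.
by rewrite -lee_fin !mine_fin le_min2//; exact: point_le.
Qed.

Let after (n : nat) w s := (n == 0%N) || (t n.-1 w < s%:E)%E.

Let afterP n w s j : after n w s -> (j < n)%N -> (t j w < s%:E)%E.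
Proof.
case: n => [//|n] /=; rewrite /after/= => tns jn.
by apply: le_lt_trans tns; exact: point_le.
Qed.

(** Clipping at [b] is invisible to the times up to [b], and clipping at [a] to
   the times after [a]. *)
Let step_itvE n w s : a < s ->
  ((s <= b) && (after n w s && (s%:E <= t n w)%E)) = (e n w < s <= e n.+1 w).
Proof.
move=> as_; rewrite [e n.+1 w]/=  le_max (leNgt s a) as_/= -(lee_fin s (fine _)) mine_fin.
rewrite le_min lee_fin.
have [sb|bs] := leP s b; last first.
  by rewrite /= !andbF.
rewrite andbT; congr (_ && _); case: n => [|n]; first by rewrite /after/= as_.
by rewrite /after/e/= gt_max as_ -(lte_fin (fine _)) mine_fin gt_min lte_fin (le_gtF sb) orbF.
Qed.

Let stopped_after n w s j : after n w s -> (j < n)%N ->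
  stopped_point t (w, s) j = fine (t j w).
Proof. by move=> h jn; rewrite stopped_point_id//= ltW// (afterP h). Qed.

Let region (n : nat) w s := [&& a <= s, s <= b, after n w s & (s%:E <= t n w)%E].

(** The left end [a] belongs to the region because a point at [a] counts in the
   window; being negligible, it does not affect the integral. *)
Let regionD n w : [set s | region n w s] `\ a = `]e n w, e n.+1 w]%classic.
Proof.
apply/seteqP; split => s /=; rewrite in_itv/=.
  move=> [/and4P[as_ sb s1 s2] /eqP sa].
  by rewrite -step_itvE ?sb ?s1 ?s2// lt_def as_ andbT.
move=> h; have as_ : a < s by case/andP: h => + _; exact/le_lt_trans/e_ge.
split; last by move=> sa; rewrite sa ltxx in as_.
by move: h; rewrite -step_itvE// /region (ltW as_).
Qed.

Let before n w s u : (s%:E <= t n w)%E -> u <= s ->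
  lam u w = lamn n (stopped_point t (w, s)) u.
Proof.
move=> sn us; apply: hawkes_intensity_trunc => //.
by rewrite (le_trans _ sn)// lee_fin.
Qed.

(** The integrand of the [n]-th step: the running value of the exponential times
   [tau * (chi - 1)], as a function of the clock and of the stopped points. *)
Let C n (z : Omega * R) : R :=
  let s := Num.max 0 z.2 in let x := stopped_point t z in
  if [&& a <= s, s <= b, (n == 0%N) || (x n.-1 < s) & ~~ (x n < s)]
  then \prod_(0 <= j < n)
         (if a <= x j <= b then chi (lamn n x (x j)) else 1)
       * expR (- (tau * \int[leb]_(u in `[a, s]) kap (lamn n x u)))
       * (tau * (chi (lamn n x s) - 1))
  else 0.

Let jump_product_ge0 n w : 0 <= jump_product n w.
Proof.
by apply: prodr_ge0 => j _; rewrite /jump_factor; case: ifP => // _; exact: chi_ge0.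
Qed.

Let C_ge0 n z : 0 <= C n z.
Proof.
rewrite /C/=; case: ifP => // _; rewrite mulr_ge0 ?chi_sign// mulr_ge0 ?expR_ge0//.
by apply: prodr_ge0 => j _; case: ifP => // _; exact: chi_ge0.
Qed.

Let mC n : measurable_fun setT (C n : predictableType t -> R).
Proof.
have ms := @measurable_time _ _ _ t.
have mx := measurable_stopped_point spp.
have mlx (v : predictableType t -> R) : measurable_fun setT v ->
    measurable_fun setT
      (fun z : predictableType t => chi (lamn n (stopped_point t z) (v z))).
  move=> mv; apply: (measurableT_comp mchi).
  by apply: measurable_intensity_trunc => // j; exact: mx.
apply: measurable_fun_ifT => //.
  apply: measurable_and; first exact: measurable_fun_ler.
  apply: measurable_and; first exact: measurable_fun_ler.
  apply: measurable_and.
    case: n {mlx} => [|n] /=; first exact: measurable_cst.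
    exact: measurable_fun_ltr.
  by apply: measurable_neg; exact: measurable_fun_ltr.
apply: measurable_funM; last first.
  by apply: measurable_funM => //; apply: measurable_funB => //; exact: mlx.
apply: measurable_funM.
  elim: {-2}n => [|m IH]; first by under eq_fun do rewrite big_geq//; exact: measurable_cst.
  under eq_fun do rewrite big_nat_recr//=.
  apply: measurable_funM => //; apply: measurable_fun_ifT => //; last exact: mlx.
  by apply: measurable_and; exact: measurable_fun_ler.
apply: measurableT_comp => //; apply: measurableT_comp => //.
apply: measurable_funM => //.
apply: (@measurable_Rintegral_upto _ (predictableType t) R
  (fun p => kap (lamn n (stopped_point t p.1) p.2))) => //.
  apply: (measurableT_comp mkap); apply: measurable_intensity_trunc => // j.
  exact: (measurableT_comp (mx j)).
by move=> z; exact: kap_ge0.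
Qed.

Let CE n w s : 0 < s -> C n (w, s) =
  if region n w s then jump_product n w * expR (- (tau * J w s)) *
    (tau * (chi (lam s w) - 1)) else 0.
Proof.
move=> s0; rewrite /C/= (max_idPr (ltW s0)) !stopped_point_lt//= -leNgt.
rewrite -/(after n w s) -/(region n w s); case: ifP => // /and4P[as_ sb sa sn].
have l u : u <= s -> lam u w = lamn n (stopped_point t (w, s)) u by exact: before.
have -> : \int[leb]_(u in `[a, s]) kap (lamn n (stopped_point t (w, s)) u) = J w s.
  by apply: eq_Rintegral => u; rewrite inE/= in_itv/= => /andP[_ us]; rewrite l.
rewrite -l//; congr (_ * _ * _).
apply: eq_big_nat => j /andP[_ jn]; rewrite (stopped_after sa jn) /jump_factor.
have := afterP sa jn; have := point_gt0 spp j w.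
case: (t j w) => // r r0 rs; rewrite !lee_fin /=; case: ifP => // _.
by rewrite l// ltW// -lte_fin.
Qed.

(** The continuous function with which the intensity agrees inside the [n]-th
   step. *)
Let lamc n w s := mu + rho * \sum_(0 <= j < n) g (s - fine (t j w)).

Let lamc_ge n w s : mu <= lamc n w s.
Proof. by rewrite lerDl mulr_ge0// sumr_ge0. Qed.

Let lamcE n w s : e n w < s <= e n.+1 w -> lam s w = lamc n w s.
Proof.
move=> h; have as_ : a < s by case/andP: h => + _; exact/le_lt_trans/e_ge.
move: h; rewrite -step_itvE// => /and3P[sb sa sn].
rewrite (before sn (lexx s)) /lamn /intensity_trunc big_mkcond/=.
congr (_ + _ * _); apply: eq_big_nat => j /andP[_ jn].
by rewrite stopped_point_lt//= (afterP sa jn) (stopped_after sa jn).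
Qed.

Let lamc_cont n w : continuous (lamc n w).
Proof.
have sum_cont m : continuous (fun s => \sum_(0 <= j < m) g (s - fine (t j w))).
  elim: m => [|m IH].
    rewrite (_ : (fun s => _) = cst 0); first by move=> ?; exact: cvg_cst.
    by apply/funext => s; rewrite big_geq.
  rewrite (_ : (fun s => _) = (fun s => \sum_(0 <= j < m) g (s - fine (t j w)) +
    g (s - fine (t m w)))); last by apply/funext => s; rewrite big_nat_recr.
  move=> s; apply: cvgD; first exact: IH.
  apply: continuous_comp; last exact: g_cont.
  by apply: cvgB; [exact: cvg_id|exact: cvg_cst].
move=> s; apply: cvgD; first exact: cvg_cst.
by apply: cvgM; [exact: cvg_cst|exact: sum_cont].
Qed.

Let phi n w s := kap (lamc n w s).

Let phi_cont n w : continuous (phi n w).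
Proof.
move=> s; apply: (continuous_comp (@lamc_cont n w s)).
apply: cvgM; last exact: cvg_id.
apply: cvgM; first exact: cvg_cst.
apply: cvgB; last exact: cvg_cst.
exact/chi_cont/lamc_ge.
Qed.

Let mlam w : measurable_fun setT (lam ^~ w).
Proof.
have ml := measurable_hawkes_intensity mu rho spp mg.
exact: (measurableT_comp ml (pair1_measurable w)).
Qed.

Let kap_bound l : mu <= l -> `|kap l| <= c.
Proof. by move=> mul; rewrite ger0_norm ?kap_ge0//; exact: chi_lip. Qed.

Let int_kap w s : leb.-integrable `[a, s] (EFin \o (fun u => kap (lam u w))).
Proof.
apply: measurable_bounded_integrable => //.
- rewrite /= lebesgue_measure_itv/=; case: ifP => _; last exact: ltry.
  by rewrite -EFinB ltry.
- by apply: measurable_funTS; exact: (measurableT_comp mkap (mlam w)).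
- exists c; split; rewrite ?num_real// => y cy u _.
  exact: le_trans (kap_bound (lam_ge u w)) (ltW cy).
Qed.

Let JE n w s : e n w <= s <= e n.+1 w ->
  J w s = J w (e n w) + \int[leb]_(u in `[e n w, s]) phi n w u.
Proof.
move=> /andP[es se]; apply/eqP; rewrite addrC -subr_eq /J /compensator.
rewrite (Rintegral_itvB (int_kap w s)); [|by rewrite bnd_simp e_ge|by rewrite bnd_simp].
rewrite -Rintegral_itv_obnd_cbnd; last first.
  apply: integrableS (continuous_itv_integrable (e n w) s (@phi_cont n w)) => //.
  exact: subset_itv_oc_cc.
apply/eqP; apply: eq_Rintegral => u; rewrite inE/= in_itv/= => /andP[eu us].
by rewrite (@lamcE n)// eu (le_trans us).
Qed.

(** The value just before the jump that closes the [n]-th step. *)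
Let Y n w := jump_product n w * expR (- (tau * J w (e n.+1 w))).

(** The continuous part of the step: between points the exponential is a
   primitive of the integrand, up to the sign [tau]. *)
Let integral_C n w :
  (\int[leb]_(s in `]0%R, +oo[) (C n (w, s) * lam s w)%:E =
   (tau * (Z n w - Y n w))%R%:E)%E.
Proof.
pose D := [set s | region n w s].
pose f s := (jump_product n w *
  (phi n w s * expR (- (tau * (J w (e n w) + \int[leb]_(u in `[e n w, s]) phi n w u))))).
have fE s : e n w < s <= e n.+1 w -> C n (w, s) * lam s w = f s.
  move=> h; have as_ : a < s by case/andP: h => + _; exact/le_lt_trans/e_ge.
  rewrite CE ?(lt_trans a_gt0)// ifT; last first.
    by move: h; rewrite -step_itvE// /region (ltW as_).
  have h' : e n w <= s <= e n.+1 w by case/andP: h => /ltW -> ->.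
  rewrite /f -(JE h') /phi -(lamcE h) /kap /compensator_density; ring.
have inD s : (s \in D) = region n w s.
  by apply/idP/idP => h; [rewrite inE in h|rewrite inE].
transitivity (\int[leb]_(s in D) (C n (w, s) * lam s w)%:E)%E.
  rewrite integral_mkcond [RHS]integral_mkcond; apply: eq_integral => s _.
  rewrite !patchE inD mem_setE in_itv/= andbT; case: ifPn => [s0|].
    by rewrite CE//; case: ifPn => // _; rewrite mul0r.
  rewrite -leNgt => s0; case: ifPn => // /and4P[as_ _ _ _].
  by have := lt_le_trans a_gt0 (le_trans as_ s0); rewrite ltxx.
have mC' : measurable_fun setT (fun s => (C n (w, s) * lam s w)%:E).
  apply/measurable_EFinP; apply: measurable_funM => //.
  exact: (measurableT_comp (measurable_predictableT spp (@mC n))).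
rewrite -(@integral_setD1 _ _ a); last 2 first.
- by rewrite regionD.
- exact: measurable_funTS.
have mh : measurable_fun setT (fun s => phi n w s *
    expR (- (tau * (J w (e n w) + \int[leb]_(u in `[e n w, s]) phi n w u)))).
  have mphi := continuous_measurable_fun (@phi_cont n w).
  apply: measurable_funM => //; apply: measurableT_comp => //.
  apply: measurableT_comp => //; apply: measurable_funM => //.
  apply: measurable_funD => //.
  apply: (@measurable_Rintegral_upto _ _ R (fun p : R * R => phi n w p.2) _ id) => //.
    exact: (measurableT_comp mphi).
  by move=> z; rewrite /phi kap_ge0.
rewrite regionD; transitivity (\int[leb]_(s in `]e n w, e n.+1 w]) (f s)%:E)%E.
  by apply: eq_integral => s; rewrite inE/= in_itv/= => h; rewrite fE.
rewrite integral_itv_obnd_cbnd; last first.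
  by apply/measurable_funTS/measurable_EFinP; exact: measurable_funM.
under eq_integral do rewrite /f EFinM.
rewrite ge0_integralZl//; last 3 first.
- by apply/measurable_funTS/measurable_EFinP.
- by move=> s _; rewrite lee_fin mulr_ge0 ?expR_ge0// /phi kap_ge0.
- by rewrite lee_fin jump_product_ge0.
rewrite integral_exp_primitive// -JE ?e_nd ?lexx//.
by rewrite -EFinM mulrCA mulrBr.
Qed.

(** The jump part of the step: only the point of index [n] is in the region. *)
Let sum_C n w :
  (\sum_(0 <= j <oo) (if t j w is r%:E then (C n (w, r))%:E else 0) =
   (tau * (Z n.+1 w - Y n w))%:E)%E.
Proof.
have C0 j w' : (0 <= if t j w' is r%:E then (C n (w', r))%:E else 0)%E.
  by case: (t j w') => // r; rewrite lee_fin.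
rewrite (@nneseriesD1 _ _ n xpredT)//.
rewrite eseries0 ?adde0; last first.
  move=> j _ /= jn; have := point_gt0 spp j w.
  case E : (t j w) => [r| |]// r0; rewrite CE// ifN//.
  apply/negP => /and4P[_ _ sa sn].
  case: (ltngtP j n) => [jltn|nj|jE]; last by rewrite jE eqxx in jn.
    by have := afterP sa jltn; rewrite E ltxx.
  have := point_le spp w (ltnW nj); rewrite E => tnr.
  have tnoo : (t n w < +oo)%E by rewrite (le_lt_trans tnr)// ltry.
  by have := point_lt spp nj tnoo; rewrite E ltNge sn.
rewrite /Z /exp_martingale /Y /jump_product big_nat_recr//=.
rewrite -/(jump_product n w) /jump_factor.
have := point_gt0 spp n w; case E : (t n w) => [r| |]// r0; last first.
  by rewrite leye_eq/= andbF mulr1 subrr mulr0.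
have an : after n w r.
  rewrite /after; case: n E {C0} => [//|n] E /=; rewrite -E.
  have [tn|] := ltP (t n w) +oo%E; first exact: point_lt.
  rewrite leye_eq => /eqP tn; have := point_le spp w (leqnSn n).
  by rewrite tn E.
rewrite CE// /region an E lexx !andbT !lee_fin/=.
case: ifPn => [/andP[ar rb]|_]; last by rewrite mulr1 subrr mulr0.
have -> : Num.max a (fine (mine r%:E b%:E)) = r.
  by rewrite (min_idPl _) ?lee_fin//=; exact/max_idPr.
congr EFin; ring.
Qed.

Let Jge0 w s : 0 <= J w s.
Proof. by apply: Rintegral_ge0 => u _; exact: kap_ge0. Qed.

Let Jle w s : s <= b -> J w s <= c * (b - a).
Proof.
move=> sb; have [sa|as_] := ltP s a.
  rewrite /J /compensator set_itv_ge ?bnd_simp -?ltNge// Rintegral_set0.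
  by rewrite mulr_ge0 ?subr_ge0 ?ltW// (lt_le_trans _ c_ge1).
apply: (@le_trans _ _ (\int[leb]_(u in `[a, s]) c)).
  apply: le_Rintegral => //; last by move=> u _; exact: chi_lip.
  exact: (continuous_itv_integrable a s (fun x => cvg_cst c)).
rewrite Rintegral_cst//= lebesgue_measure_itv/= lte_fin.
have c0 : 0 <= c by rewrite (le_trans _ c_ge1).
apply: ler_wpM2l => //; case: ifP => _ /=; last by rewrite subr_ge0 ltW.
by rewrite lerB.
Qed.

Let jump_product_le n w : jump_product n w <= c ^+ n.
Proof.
rewrite -[X in _ ^+ X]subn0 -prodr_const_nat; apply: ler_prod => j _.
by rewrite /jump_factor; case: ifP => _; rewrite ?chi_ge0 ?chi_le ?ler01.
Qed.

Let mjump n : measurable_fun setT (jump_product n).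
Proof.
case: (spp) => mt _ _ _ _; rewrite /jump_product.
elim: n => [|n IH].
  by under eq_fun do rewrite big_geq//; exact: measurable_cst.
under eq_fun do rewrite big_nat_recr//=.
apply: measurable_funM => //; apply: measurable_fun_ifT => //.
  by apply: measurable_and; exact: measurable_fun_lee.
apply: (measurableT_comp mchi).
have ml := measurable_hawkes_intensity mu rho spp mg.
have mp : measurable_fun setT (fun w => (w, fine (t n w))).
  by apply: measurable_fun_pair => //; apply: measurableT_comp => //; exact: mt.
exact: (measurableT_comp ml mp).
Qed.

Let mJ (s : Omega -> R) : measurable_fun setT s ->
  measurable_fun setT (fun w => J w (s w)).
Proof.
move=> ms.
apply: (@measurable_Rintegral_upto _ _ R (fun p : Omega * R => kap (lam p.2 p.1))) => //.
  exact: (measurableT_comp mkap (measurable_hawkes_intensity mu rho spp mg)).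
by move=> z; exact: kap_ge0.
Qed.

Let me n : measurable_fun setT (e n).
Proof.
case: (spp) => mt _ _ _ _; case: n => [|n]; first exact: measurable_cst.
apply: measurable_maxr => //; apply: measurableT_comp => //.
exact: measurable_mine.
Qed.

Lemma exp_martingale_ge0 n w : 0 <= Z n w.
Proof. by rewrite mulr_ge0 ?expR_ge0. Qed.

Let bounded_term n w s : a <= s <= b ->
  `|jump_product n w * expR (- (tau * J w s))| <= c ^+ n * expR (c * (b - a)).
Proof.
move=> /andP[as_ sb]; rewrite ger0_norm ?mulr_ge0 ?expR_ge0//.
apply: ler_pM; rewrite ?expR_ge0// ler_expR.
apply: le_trans (Jle w sb); rewrite -mulNr -[leRHS]mul1r ler_wpM2r//.
have := tau1; rewrite expr2 => t2; nra.
Qed.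

Let int_term n (s : Omega -> R) : measurable_fun setT s ->
  (forall w, a <= s w <= b) ->
  P.-integrable setT
    (EFin \o (fun w => jump_product n w * expR (- (tau * J w (s w))))).
Proof.
move=> ms sab; apply: (@integrable_bounded _ _ _ _ _ (c ^+ n * expR (c * (b - a)))).
  apply: measurable_funM => //; apply: measurableT_comp => //.
  by apply: measurableT_comp => //; apply: measurable_funM => //; exact: mJ.
by move=> w; exact: bounded_term.
Qed.

Lemma integrable_exp_martingale n : P.-integrable setT (EFin \o Z n).
Proof. by apply: int_term => // w; rewrite e_ge e_le. Qed.

(** The intensity identity equates the mean jump part and the mean continuous
    part of each step; the value before the jump is common to both and
    cancels. *)
Lemma expectation_exp_martingale n : \int[P]_w Z n w = 1.
Proof.
have iZ := integrable_exp_martingale.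
have iY m : P.-integrable setT (EFin \o Y m).
  by apply: int_term => // w; rewrite e_ge e_le.
elim: n => [|n IH].
  rewrite (_ : (fun w => Z 0 w) = cst 1).
    by rewrite Rintegral_cst// [X in fine X]probability_setT mulr1.
  apply/funext => w; rewrite /Z /exp_martingale /jump_product big_geq// mul1r.
  by rewrite /e/= /J /compensator set_itv1 Rintegral_set1 mulr0 oppr0 expR0.
have eqe : (\int[P]_w (tau * (Z n.+1 w - Y n w))%:E =
            \int[P]_w (tau * (Z n w - Y n w))%:E)%E.
  transitivity (\int[P]_w
      \sum_(0 <= j <oo) (if t j w is r%:E then (C n (w, r))%:E else 0))%E.
    by apply: eq_integral => w _; rewrite sum_C.
  rewrite (si (measurable_predictable (@mC n)) (@C_ge0 n)).
  by apply: eq_integral => w _; rewrite integral_C.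
by rewrite -IH; exact: (Rintegral_shift (iZ n.+1) (iZ n) (iY n) tau1 eqe).
Qed.

End ExponentialMartingale.

(** * Strict concavity of the likelihood *)

Section LogTangent.
Context (R : realType).

(** The tangent bound for the concave logarithm, strict away from the point of
    contact and valid at [v = 0]. *)
Lemma lne_lt_tangent (u v : R) : 0 < u -> 0 <= v -> v != u ->
  (lne v%:E < (ln u + (v - u) / u)%:E)%E.
Proof.
move=> u0; rewrite le_eqVlt => /predU1P[<- _|v0 vu].
  by rewrite le0_lneNy ?ltNyr.
rewrite lne_EFin// lte_fin.
have x0 : ln v - ln u != 0.
  by apply: contra_neq vu => /subr0_eq; exact: ln_inj.
rewrite -ltrBlDl -(ltrD2l 1); apply: lt_le_trans (expR_gt1Dx x0) _.
rewrite -ln_div ?posrE// lnK ?posrE ?divr_gt0// mulrBl divff ?gt_eqF//.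
by rewrite addrC subrK.
Qed.

Lemma sum_lne_tangent (r : seq nat) (p : pred nat) (x : nat -> R) (m m' : R) :
  0 < m -> 0 <= m' -> m' != m -> (forall i, 0 <= x i) ->
  let B := \sum_(i <- r | p i) (ln (m + x i) + (m' - m) / (m + x i)) in
  ((\sum_(i <- r | p i) lne (m' + x i)%:E <= B%:E) /\
   (has p r -> \sum_(i <- r | p i) lne (m' + x i)%:E < B%:E))%E.
Proof.
move=> m0 m'0 mm x0 /=; elim: r => [|i r [IH1 IH2]]; first by rewrite !big_nil.
rewrite !big_cons/=; case: (p i) => //=.
suff h : (lne (m' + x i)%:E + \sum_(i <- r | p i) lne (m' + x i)%:E <
   ((ln (m + x i) + (m' - m) / (m + x i)) +
    \sum_(i <- r | p i) (ln (m + x i) + (m' - m) / (m + x i)))%:E)%E.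
  by split => [|_]; [exact: ltW|].
suff h : (lne (m' + x i)%:E < (ln (m + x i) + (m' - m) / (m + x i))%:E)%E.
  move: (lne _) (\sum_(_ <- _ | _) lne _)%E h IH1 => [u| |] [v| |]//=;
    rewrite ?lte_fin ?lee_fin ?ltNyr// => h1 h2.
  exact: ltr_leD.
have -> : m' - m = (m' + x i) - (m + x i) by ring.
apply: lne_lt_tangent; first by rewrite ltr_wpDr.
  by rewrite addr_ge0.
by apply: contra_neq mm => /addIr.
Qed.

(** The tangent at [m] lies above the function on both sides, and strictly on the
    side towards which it does not increase: with a horizontal tangent there is
    at least one logarithm, whose concavity is strict, and otherwise the slope
    decides. With no logarithm at all the slope is [- L < 0]. This form of strict
    concavity covers the value [-oo] at 0 and yields uniqueness of maximisers. *)
Lemma poisson_loglik_no_interior_min (r : seq nat) (p : pred nat) (x : nat -> R)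
    (L m1 m m2 : R) : 0 < L -> (forall i, 0 <= x i) -> 0 <= m1 -> m1 < m -> m < m2 ->
  let l v := (\sum_(i <- r | p i) lne (v + x i)%:E - (v * L)%:E)%E in
  ((l m1 < l m) \/ (l m2 < l m))%E.
Proof.
move=> L0 x0 m10 m1m mm2 l.
have m0 : 0 < m by exact: le_lt_trans m1m.
pose A := \sum_(i <- r | p i) ln (m + x i).
pose S := \sum_(i <- r | p i) (m + x i)^-1.
have lm : l m = (A - m * L)%:E.
  rewrite /l EFinB; congr (_ - _)%E; rewrite /A -sumEFin.
  by apply: eq_bigr => i _; rewrite lne_EFin// ltr_wpDr.
have tangent v : 0 <= v -> v != m ->
    ((l v <= (A - m * L + (v - m) * (S - L))%:E) /\
     (has p r -> l v < (A - m * L + (v - m) * (S - L))%:E))%E.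
  move=> v0 vm; have := sum_lne_tangent r p m0 v0 vm x0; rewrite /=.
  have -> : \sum_(i <- r | p i) (ln (m + x i) + (v - m) / (m + x i)) = A + (v - m) * S.
    by rewrite big_split/= -mulr_sumr.
  have -> : (A - m * L + (v - m) * (S - L)) = (A + (v - m) * S) - v * L by ring.
  by rewrite [in X in _ -> X]EFinB => -[h1 h2]; split => [|/h2 h];
    rewrite /l; [exact: leeB|exact: lte_leB].
have [SL|LS] := ltP S L.
  right; have [h _] := tangent m2 (ltW (lt_trans m0 mm2)) (negbT (gt_eqF mm2)).
  apply: le_lt_trans h _; rewrite lm lte_fin gtrDl.
  by rewrite nmulr_llt0 ?subr_gt0// subr_lt0.
left; have [_] := tangent m1 m10 (negbT (lt_eqF m1m)).
have -> : has p r.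
  apply: contraT => hp; move: LS; rewrite /S big_hasC// leNgt L0.
  by [].
move=> /(_ isT) h; apply: lt_le_trans h _; rewrite lm lee_fin gerDl.
by rewrite mulr_le0_ge0 ?subr_le0 ?subr_ge0// ltW.
Qed.

End LogTangent.

Section MaximumLikelihood.
Context (d : measure_display) (Omega : measurableType d) (R : realType).
Variables (t : nat -> Omega -> \bar R) (rho : R) (g : R -> R).
Hypothesis spp : simple_point_process t.
Hypothesis mg : measurable_fun setT g.
Hypothesis rho_ge0 : 0 <= rho.
Hypothesis g_ge0 : forall s : R, 0 <= g s.
Variables (a b : R).
Hypothesis ab : a < b.

Let E := excitation rho g t.
Let ell := log_likelihood rho g t a b.

Lemma excitation_ge0 i w : 0 <= E i w.
Proof. by rewrite mulr_ge0// sumr_ge0. Qed.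

(** All points of the window have index less than [n] once [t_n] is beyond it. *)
Lemma log_likelihood_trunc n w m : (b%:E < t n w)%E ->
  ell w m = (\sum_(0 <= i < n | (a%:E <= t i w <= b%:E)%E) lne (m + E i w)%:E
             - (m * (b - a))%:E)%E.
Proof.
move=> bn; rewrite /ell /log_likelihood; congr (_ - _)%E.
apply: (@fsbig_nat _ _ _ n (fun i => (a%:E <= t i w <= b%:E)%E)) => i /andP[_ ib].
rewrite ltnNge; apply/negP => ni.
by have := lt_le_trans bn (le_trans (point_le spp w ni) ib); rewrite ltxx.
Qed.

Lemma log_likelihood_no_interior_min w m1 m m2 : 0 <= m1 -> m1 < m -> m < m2 ->
  ((ell w m1 < ell w m) \/ (ell w m2 < ell w m))%E.
Proof.
move=> m10 m1m mm2; have [n bn] := point_gt spp w b.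
rewrite !(log_likelihood_trunc _ bn).
apply: poisson_loglik_no_interior_min => //; first by rewrite subr_gt0.
by move=> i; exact: excitation_ge0.
Qed.

(** The alternative left by strict concavity, that the likelihood at the
    maximiser is smaller, is excluded. *)
Lemma mle_gt w mh v m : is_mle rho g t a b w mh -> 0 <= v -> v < m -> m < mh ->
  (ell w v < ell w m)%E.
Proof.
move=> [mh0 mhmax] v0 vm mmh.
have [//|] := log_likelihood_no_interior_min w v0 vm mmh.
by rewrite ltNge mhmax// (le_trans v0)// ltW.
Qed.

Lemma mle_lt w mh v m : is_mle rho g t a b w mh -> mh < m -> m < v ->
  (ell w v < ell w m)%E.
Proof.
move=> [mh0 mhmax] mhm mv.
have [|//] := log_likelihood_no_interior_min w mh0 mhm mv.
by rewrite ltNge mhmax// (le_trans mh0)// ltW.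
Qed.

Lemma measurable_loglik_lt m1 m2 : 0 <= m1 -> 0 <= m2 ->
  measurable [set w | (ell w m1 < ell w m2)%E].
Proof.
case: (spp) => mt _ _ _ _ m10 m20.
have mE i : measurable_fun setT (E i).
  apply: measurable_funM => //; elim: {-2}i => [|k IH].
    by under eq_fun do rewrite big_geq//; exact: measurable_cst.
  under eq_fun do rewrite big_nat_recr//=.
  apply: measurable_funD => //; apply: (measurableT_comp mg).
  by apply: measurable_funB; apply: measurableT_comp => //; exact: mt.
pose l n m w := (\sum_(0 <= i < n) (if (a%:E <= t i w <= b%:E)%E
   then lne (m + E i w)%:E else 0) - (m * (b - a))%:E)%E.
have ml n m : measurable_fun setT (l n m).
  apply: emeasurable_funB => //; elim: n => [|k IH].
    by under eq_fun do rewrite big_geq//; exact: measurable_cst.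
  under eq_fun do rewrite big_nat_recr//=.
  apply: emeasurable_funD => //; apply: measurable_fun_ifT => //.
    by apply: measurable_and; exact: measurable_fun_lee.
  rewrite (_ : (fun w => lne (m + E k w)%:E) =
    (fun w => if 0 < m + E k w then (ln (m + E k w))%:E else -oo%E)).
    have mmE : measurable_fun setT (fun w => m + E k w) by exact: measurable_funD.
    apply: measurable_fun_ifT => //; first exact: measurable_fun_ltr.
    by apply/measurable_EFinP; exact: (measurableT_comp (@measurable_ln R)).
  apply/funext => w; case: ifPn => [h|]; first by rewrite lne_EFin.
  by rewrite -leNgt => h; rewrite le0_lneNy.
rewrite (_ : [set w | _] =
  \bigcup_n ([set w | (b%:E < t n w)%E] `&` [set w | (l n m1 w < l n m2 w)%E])).
  apply: bigcup_measurable => n _; apply: measurableI.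
    by rewrite -[X in measurable X]setTI; exact: emeasurable_fun_o_infty.
  by rewrite -[X in measurable X]setTI; exact: measurable_lte.
apply/seteqP; split => w /=.
  move=> h; have [n bn] := point_gt spp w b; exists n => //; split => //=.
  by move: h; rewrite !(log_likelihood_trunc _ bn) /l -!big_mkcond.
by move=> [n _ [/= bn]]; rewrite !(log_likelihood_trunc _ bn) /l -!big_mkcond.
Qed.

(** By strict concavity the maximiser exceeds [c >= 0] if and only if some
    rational [q > c] has a greater likelihood than [c]. *)
Lemma measurable_mle (mh : Omega -> R) :
  (forall w, is_mle rho g t a b w (mh w)) -> measurable_fun setT mh.
Proof.
move=> mle; apply: (measurability _ (RGenOInfty.measurableE R)) => _ [_ [c ->] <-].
rewrite setTI; have [c0|c0] := leP 0 c; last first.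
  rewrite (_ : _ @^-1` _ = setT)//; apply/seteqP; split => // w _ /=.
  by rewrite in_itv/= andbT (lt_le_trans c0)//; case: (mle w).
rewrite (_ : _ @^-1` _ = \bigcup_(q : rat)
    [set w | (c < ratr q) /\ (ell w c < ell w (ratr q))%E]).
  apply: bigcupT_measurable_rat => q; have [cq|qc] := ltP c (ratr q); last first.
    by rewrite (_ : [set w | _] = set0)//; apply/seteqP; split => // w [].
  rewrite (_ : [set w | _] = [set w | (ell w c < ell w (ratr q))%E]).
    by apply: measurable_loglik_lt => //; rewrite (le_trans c0)// ltW.
  by apply/seteqP; split => w //= [].
apply/seteqP; split => w /=; rewrite in_itv/= andbT.
  by move=> /rat_in_itvoo[q]; rewrite in_itv/= => /andP[cq qm]; exists q => //=;
    split => //; exact: mle_gt (mle w) c0 cq qm.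
move=> [q _ /= [cq lq]]; rewrite ltNge; apply/negP; rewrite le_eqVlt => /predU1P[mc|mc].
  have [_ h] := mle w; have := h (ratr q) (le_trans c0 (ltW cq)).
  by rewrite mc => hq; have := lt_le_trans lq hq; rewrite ltxx.
by have := mle_lt (mle w) mc cq; rewrite ltNge (ltW lq).
Qed.

End MaximumLikelihood.

(** * Likelihood ratios and information *)

(** The square root of the ratio of the intensities under the baselines [mu + v]
    and [mu]. Taking the square root of the likelihood ratio, rather than the
    ratio itself, is what leaves a nonnegative remainder, the Hellinger distance
    of [root_ratio_gap]. The restriction on [v] keeps both intensities
    positive and the ratio bounded. *)
Section RootRatio.
Context (R : realType).
Variables (mu v : R).
Hypotheses (mu_gt0 : 0 < mu) (v_neq0 : v != 0) (v_small : `|v| <= mu / 2).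

Definition root_ratio (l : R) : R := expR ((ln (l + v) - ln l) / 2).
Let r := root_ratio.
Let tau := Num.sg v.

Let vbound : - (mu / 2) <= v <= mu / 2. Proof. by rewrite -ler_norml. Qed.

Let shift_gt0 l : mu <= l -> 0 < l + v.
Proof. by move=> ml; move: vbound mu_gt0 => /andP[]; lra. Qed.

Lemma root_ratio_gt0 l : 0 < r l. Proof. exact: expR_gt0. Qed.

Lemma root_ratio_sqr l : mu <= l -> r l ^+ 2 * l = l + v.
Proof.
move=> ml; have l0 : 0 < l by exact: lt_le_trans ml.
have -> : r l ^+ 2 = expR (ln (l + v) - ln l).
  by rewrite -expRM_natl; congr expR; field.
by rewrite expRB !lnK ?posrE ?shift_gt0// divfK// gt_eqF.
Qed.

Lemma root_ratio_sign l : mu <= l -> 0 <= tau * (r l - 1).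
Proof.
move=> ml; have l0 : 0 < l by exact: lt_le_trans ml.
have := root_ratio_sqr ml; have := root_ratio_gt0 l; rewrite -/(r l).
move: (r l) => x x0 xl; rewrite /tau; case: sgrP v_neq0 => //= v0 _.
  rewrite mul1r subr_ge0 leNgt; apply/negP => x1.
  have : x ^+ 2 < 1 by rewrite expr_lt1// ltW.
  by rewrite -(ltr_pM2r l0) xl mul1r; lra.
rewrite mulN1r oppr_ge0 subr_le0 leNgt; apply/negP => x1.
have : 1 < x ^+ 2 by rewrite expr_gt1// ltW.
by rewrite -(ltr_pM2r l0) xl mul1r; lra.
Qed.

Lemma root_ratio_le2 l : mu <= l -> r l <= 2.
Proof.
move=> ml; have l0 : 0 < l by exact: lt_le_trans ml.
have := root_ratio_sqr ml; have := root_ratio_gt0 l; rewrite -/(r l).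
move: (r l) => x x0 xl; rewrite leNgt; apply/negP => x2.
have : 4 < x ^+ 2 by nra.
by rewrite -(ltr_pM2r l0) xl; move: vbound => /andP[]; lra.
Qed.

Lemma root_ratio_lip l : mu <= l -> tau * (r l - 1) * l <= mu.
Proof.
move=> ml; have l0 : 0 < l by exact: lt_le_trans ml.
have := root_ratio_sqr ml; have := root_ratio_gt0 l; have := root_ratio_sign ml.
rewrite -/(r l); move: (r l) => x h x0 xl.
have e : tau * (x - 1) * l * (x + 1) = `|v|.
  rewrite (_ : _ * (x + 1) = tau * (x ^+ 2 * l - l)); last by ring.
  by rewrite xl addrAC subrr add0r -normrEsg.
have h2 : 0 <= tau * (x - 1) * l by rewrite mulr_ge0// ltW.
move: e h2; set y := _ * l => e h2.
have : y * 1 <= y * (x + 1) by rewrite ler_wpM2l// lerDr ltW.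
by rewrite e; move: v_small mu_gt0; lra.
Qed.

(** The right-hand side is [l * (r - 1) ^ 2 / 2], and
    [r - 1 = v / (l * (r + 1))] with [r + 1 <= 3]: hence 18 = 2 * 9. *)
Lemma root_ratio_gap l : mu <= l -> v ^+ 2 / 18 * l^-1 <= v / 2 - (r l - 1) * l.
Proof.
move=> ml; have l0 : 0 < l by exact: lt_le_trans ml.
have := root_ratio_sqr ml; have := root_ratio_le2 ml; have := root_ratio_gt0 l.
rewrite -/(r l); move: (r l) => x x0 x2 xl.
rewrite ler_pdivrMr//.
have -> : v = x ^+ 2 * l - l by rewrite xl; ring.
have -> : (x ^+ 2 * l - l) / 2 - (x - 1) * l = (x - 1) ^+ 2 * l / 2 by field.
have -> : (x ^+ 2 * l - l) ^+ 2 / 18 = (x - 1) ^+ 2 * l ^+ 2 / 2 * ((x + 1) ^+ 2 / 9) by field.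
have -> : (x - 1) ^+ 2 * l / 2 * l = (x - 1) ^+ 2 * l ^+ 2 / 2 * 1 by field.
apply: ler_wpM2l.
  by apply: mulr_ge0; [apply: mulr_ge0; exact: sqr_ge0|rewrite invr_ge0].
by rewrite ler_pdivrMr// mul1r; nra.
Qed.

Lemma root_ratio_continuous l : mu <= l -> {for l, continuous r}.
Proof.
move=> ml; have l0 : 0 < l by exact: lt_le_trans ml.
apply: (@continuous_comp _ _ _ (fun l => (ln (l + v) - ln l) / 2) expR);
  last exact: continuous_expR.
apply: cvgM; last exact: cvg_cst.
apply: cvgB; last exact: continuous_ln.
apply: (@continuous_comp _ _ _ (fun l => l + v) (@ln R)).
  by apply: cvgD; [exact: cvg_id|exact: cvg_cst].
exact/continuous_ln/shift_gt0.
Qed.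

Lemma measurable_root_ratio : measurable_fun setT r.
Proof.
apply: measurableT_comp => //; apply: measurable_funM => //.
apply: measurable_funB => //.
by apply: measurableT_comp => //; exact: measurable_funD.
Qed.

End RootRatio.

Section LikelihoodDeviation.
Context (d : measure_display) (Omega : measurableType d) (R : realType).
Variables (P : probability Omega R).
Variables (t : nat -> Omega -> \bar R) (mu rho : R) (g : R -> R).
Hypothesis spp : simple_point_process t.
Let lam := hawkes_intensity mu rho g t.
Hypothesis si : stochastic_intensity P t lam.
Hypotheses (mu_gt0 : 0 < mu) (rho_ge0 : 0 <= rho).
Hypothesis g_cont : continuous g.
Hypothesis g_ge0 : forall s : R, 0 <= g s.
Variables (a b : R).
Hypotheses (a_gt0 : 0 < a) (ab : a < b).

Local Notation leb := (@lebesgue_measure R).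
Let ell := log_likelihood rho g t a b.
Let Q := baseline_information mu rho g t a b.

Let mg : measurable_fun setT g. Proof. exact: continuous_measurable_fun. Qed.
Let mlam := measurable_hawkes_intensity mu rho spp mg.
Let lam_ge s w : mu <= lam s w. Proof. exact: hawkes_intensity_ge. Qed.
Let lam_gt0 s w : 0 < lam s w. Proof. exact: hawkes_intensity_gt0. Qed.

Lemma measurable_baseline_information : measurable_fun setT Q.
Proof.
apply: measurable_funM => //.
apply: (@measurable_Rintegral_upto _ _ R (fun p : Omega * R => (lam p.2 p.1)^-1) a
  (fun=> b)) => //.
- rewrite (_ : (fun p : Omega * R => (lam p.2 p.1)^-1) =
    (fun p => powR (lam p.2 p.1) (-1))).
    exact: (measurableT_comp (@measurable_powR R (-1)) mlam).
  by apply/funext => p; rewrite powR_inv1// ltW.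
- by move=> z; rewrite invr_ge0 ltW.
Qed.

Let int_bounded (f : R -> R) B : measurable_fun setT f -> (forall s, `|f s| <= B) ->
  leb.-integrable `[a, b] (EFin \o f).
Proof.
move=> mf fB; apply: measurable_bounded_integrable => //.
- by rewrite /= lebesgue_measure_itv/= lte_fin ab -EFinB ltry.
- exact: measurable_funTS.
- by exists B; split; rewrite ?num_real// => y By u _; exact: le_trans (fB u) (ltW By).
Qed.

Variable v : R.
Hypotheses (v_neq0 : v != 0) (v_small : `|v| <= mu / 2).
Let chi := root_ratio v.
Let tau := Num.sg v.
Let tau1 : tau ^+ 2 = 1. Proof. by rewrite /tau sqr_sg v_neq0. Qed.
Let Z := exp_martingale t mu rho g a b chi tau.

(** On the window the exponential equals the square root of the likelihood ratio
    times the exponential of the integral of [v / 2 - (chi - 1) * lambda], because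
    the likelihood ratio itself carries the term [- v * (b - a)]. *)
Lemma exp_martingale_ge n w : (b%:E < t n w)%E -> (ell w mu < ell w (mu + v))%E ->
  expR (v ^+ 2 / 18 * \int[leb]_(s in `[a, b]) (lam s w)^-1) <= Z n.+1 w.
Proof.
move=> bn; rewrite /ell.
have bn1 : (b%:E < t n.+1 w)%E by rewrite (lt_le_trans bn)// point_le.
rewrite !(log_likelihood_trunc rho g spp a _ bn1).
have E0 i : 0 <= excitation rho g t i w by exact: excitation_ge0.
pose p i := (a%:E <= t i w <= b%:E)%E.
have sumE m : 0 < m ->
    (\sum_(0 <= i < n.+1 | p i) lne (m + excitation rho g t i w)%:E =
    (\sum_(0 <= i < n.+1 | p i) ln (m + excitation rho g t i w))%:E)%E.
  by move=> m0; rewrite -sumEFin; apply: eq_bigr => i _; rewrite lne_EFin// ltr_wpDr.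
have vb : - (mu / 2) <= v <= mu / 2 by rewrite -ler_norml.
have mv0 : 0 < mu + v by move: vb mu_gt0 => /andP[]; lra.
rewrite !sumE// -!EFinB lte_fin => hl.
(* The index [n.+1] lets the last step end at the end of the window; the point of
   index [n] lies beyond it and contributes no factor. *)
rewrite /Z /exp_martingale.
have -> : clipped_point t a b n.+1 w = b.
  rewrite /= (min_idPr (ltW bn))/=; exact/max_idPr/ltW.
have -> : jump_product t mu rho g a b chi n.+1 w =
   expR ((\sum_(0 <= i < n.+1 | p i) ln (mu + v + excitation rho g t i w) -
          \sum_(0 <= i < n.+1 | p i) ln (mu + excitation rho g t i w)) / 2).
  rewrite -sumrB mulr_suml expR_sum [RHS]big_mkcond/=; apply: eq_bigr => i _.
  rewrite /jump_factor -/(p i); case: ifPn => // /andP[_ ib].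
  rewrite hawkes_intensity_point//; last by rewrite (le_lt_trans ib)// ltry.
  by rewrite /chi /root_ratio addrAC.
rewrite -expRD ler_expR.
have mlw : measurable_fun setT (lam ^~ w).
  exact: (measurableT_comp mlam (pair1_measurable w)).
have mh : measurable_fun setT (fun s => (chi (lam s w) - 1) * lam s w).
  apply: measurable_funM => //; apply: measurable_funB => //.
  exact: (measurableT_comp (measurable_root_ratio v) mlw).
have ih : leb.-integrable `[a, b] (EFin \o (fun s => (chi (lam s w) - 1) * lam s w)).
  apply: (@int_bounded _ mu) => // s.
  rewrite -[leLHS]mul1r -[X in X * _](_ : `|tau| = 1); last first.
    by rewrite normr_sg v_neq0.
  rewrite -normrM mulrA ger0_norm; first exact: (root_ratio_lip mu_gt0 v_neq0 v_small).
  by apply: mulr_ge0; [exact: (root_ratio_sign mu_gt0 v_neq0 v_small)|exact: ltW].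
have ilam : leb.-integrable `[a, b] (EFin \o (fun s => (lam s w)^-1)).
  apply: (@int_bounded _ mu^-1).
    rewrite (_ : (fun s => _) = (fun s => powR (lam s w) (-1))).
      exact: (measurableT_comp (@measurable_powR R (-1)) mlw).
    by apply/funext => s; rewrite powR_inv1// ltW.
  move=> s; rewrite ger0_norm; last by rewrite invr_ge0 ltW.
  by rewrite lef_pV2 ?posrE.
have tJ : tau * compensator t mu rho g a chi tau w b =
    \int[leb]_(s in `[a, b]) ((chi (lam s w) - 1) * lam s w).
  rewrite /compensator.
  under eq_Rintegral do rewrite /compensator_density -mulrA.
  by rewrite RintegralZl// mulrA -expr2 tau1 mul1r.
have icst : leb.-integrable `[a, b] (EFin \o (fun=> v / 2)).
  by apply: (@int_bounded _ `|v / 2|).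
have gap : v ^+ 2 / 18 * \int[leb]_(s in `[a, b]) (lam s w)^-1 <=
    v / 2 * (b - a) - \int[leb]_(s in `[a, b]) ((chi (lam s w) - 1) * lam s w).
  have -> : v / 2 * (b - a) = \int[leb]_(s in `[a, b]) (v / 2).
    by rewrite Rintegral_cst//= lebesgue_measure_itv/= lte_fin ab.
  rewrite -RintegralB// -RintegralZl//; apply: le_Rintegral => //.
  - exact: (integrableZl _ (v ^+ 2 / 18) ilam).
  - exact: (integrableB _ icst ih).
  - by move=> s _; exact: (root_ratio_gap mu_gt0 v_small).
rewrite tJ; apply: le_trans gap _; move: hl; lra.
Qed.

(** Markov's inequality for the exponential, on the events that at most [n] points
    lie in the window, which increase to the whole space. *)
Lemma proba_likelihood_exceeds (K : R) :
  (P ([set w | (ell w mu < ell w (mu + v))%E] `&` [set w | (K <= Q w)%R]) <=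
   (expR (- (v ^+ 2 / mu ^+ 2 / 18 * K)))%:E)%E.
Proof.
set A := (X in P X).
have vb : - (mu / 2) <= v <= mu / 2 by rewrite -ler_norml.
have mv0 : 0 <= mu + v by move: vb mu_gt0 => /andP[]; lra.
have mA : measurable A.
  apply: measurableI; first by apply: measurable_loglik_lt => //; exact: ltW.
  rewrite (_ : [set w | _] = Q @^-1` `[K, +oo[).
    by rewrite -[X in measurable X]setTI; exact: measurable_baseline_information.
  by apply/seteqP; split => w /=; rewrite in_itv/= andbT.
pose F n := A `&` [set w | (b%:E < t n w)%E].
have mF n : measurable (F n).
  apply: measurableI => //; case: (spp) => mt _ _ _ _.
  by rewrite -[X in measurable X]setTI; exact: emeasurable_fun_o_infty.
set c := v ^+ 2 / mu ^+ 2 / 18 * K.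
have cexp := expR_gt0 c.
have chi_ge0 l : mu <= l -> 0 <= chi l by move=> _; exact/ltW/root_ratio_gt0.
have c_ge1 : 1 <= 2 + mu by move: mu_gt0; lra.
have chi_le l : mu <= l -> chi l <= 2 + mu.
  by move=> /(root_ratio_le2 mu_gt0 v_small)/le_trans; apply; rewrite lerDl ltW.
have chi_lip l : mu <= l -> tau * (chi l - 1) * l <= 2 + mu.
  by move=> /(root_ratio_lip mu_gt0 v_neq0 v_small)/le_trans; apply; rewrite lerDr.
have chi_sign := root_ratio_sign mu_gt0 v_neq0 v_small.
have chi_cont := root_ratio_continuous mu_gt0 v_small.
have mchi := measurable_root_ratio v.
have iZ := integrable_exp_martingale P spp mu_gt0 rho_ge0 g_cont g_ge0 ab mchi tau1
  chi_ge0 chi_sign c_ge1 chi_le chi_lip.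
have Z0 n w : 0 <= Z n w by exact: exp_martingale_ge0.
have EZ n : (\int[P]_w (Z n w)%:E = 1)%E.
  have fZ := integrable_fin_num measurableT (iZ n).
  rewrite -(fineK fZ); congr EFin.
  exact: (expectation_exp_martingale spp si mu_gt0 rho_ge0 g_cont g_ge0 a_gt0 ab
    chi_cont mchi tau1 chi_ge0 chi_sign c_ge1 chi_le chi_lip n).
have PF n : (P (F n) <= (expR (- c))%:E)%E.
  have mZ : measurable_fun setT (EFin \o Z n.+1).
    by have /integrableP[] := iZ n.+1.
  pose B := [set w | ((expR c)%:E <= `|(EFin \o Z n.+1) w|)%E].
  have mB : measurable B.
    rewrite -[B]setTI; apply: measurable_lee => //.
    exact: measurableT_comp.
  have hB : ((expR c)%:E * P B <= 1)%E.
    have := le_integral_abse P measurableT mZ cexp; rewrite setTI -(EZ n.+1).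
    under [in X in (_ <= X)%E -> _]eq_integral do rewrite /= ger0_norm//.
    by [].
  move: hB; rewrite -[P B]fineK ?fin_num_measure// -EFinM lee_fin => hB.
  apply: (@le_trans _ _ (P B)).
    apply: le_measure; rewrite ?inE// => w [[/= hl KQ] bn].
    rewrite /B/= lee_fin ger0_norm//.
    apply: le_trans (exp_martingale_ge bn hl); rewrite ler_expR /c.
    have -> : v ^+ 2 / mu ^+ 2 / 18 * K = v ^+ 2 / 18 * (K / mu ^+ 2).
      by field; rewrite gt_eqF.
    apply: ler_wpM2l; first by rewrite divr_ge0// sqr_ge0.
    by rewrite ler_pdivrMr ?exprn_gt0// mulrC.
  rewrite -[P B]fineK ?fin_num_measure// lee_fin expRN.
  by rewrite -[leRHS]mulr1 ler_pdivlMl.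
have cvF : P (F n) @[n --> \oo] --> P A.
  have -> : A = \bigcup_n F n.
    apply/seteqP; split=> [w Aw|w [n _ []]//].
    by have [n bn] := point_gt spp w b; exists n.
  apply: nondecreasing_cvg_mu => //.
    exact: bigcup_measurable.
  move=> m n mn; apply/subsetPset => w [Aw bm]; split => //.
  by rewrite /= (lt_le_trans bm)// point_le.
rewrite -(cvg_lim _ cvF)//; apply: lime_le; first by apply/cvg_ex; exists (P A).
by apply: nearW => n; exact: PF.
Qed.

End LikelihoodDeviation.

(** * Bounds at a fixed scale *)

Section HawkesBounds.
Context (d : measure_display) (Omega : measurableType d) (R : realType).
Variables (P : probability Omega R).
Variables (t : nat -> Omega -> \bar R) (mu rho : R) (g : R -> R).
Hypothesis spp : simple_point_process t.
Let lam := hawkes_intensity mu rho g t.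
Hypothesis si : stochastic_intensity P t lam.
Hypotheses (mu_gt0 : 0 < mu) (rho_ge0 : 0 <= rho) (rho_lt1 : rho < 1).
Hypothesis g_cont : continuous g.
Hypothesis g_ge0 : forall s : R, 0 <= g s.
Variable G : R.
Hypothesis g_le : forall s : R, 0 <= s -> g s <= G.
Hypothesis g_mass : forall S : R, 0 < S ->
  (\int[lebesgue_measure]_(s in `]0%R, S[) (g (S - s))%:E <= 1)%E.
Variables (a b : R).
Hypotheses (a_gt0 : 0 < a) (ab : a < b).

Local Notation leb := (@lebesgue_measure R).
Let ell := log_likelihood rho g t a b.
Let Q := baseline_information mu rho g t a b.

Let mg : measurable_fun setT g. Proof. exact: continuous_measurable_fun. Qed.
Let mlam := measurable_hawkes_intensity mu rho spp mg.
Let lam_gt0 s w : 0 < lam s w. Proof. exact: hawkes_intensity_gt0. Qed.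
Let L0 : 0 < b - a. Proof. by rewrite subr_gt0. Qed.

(** The inverse lies above its tangent at [c]: [1 / l >= 2 / c - l / c ^ 2]. *)
Let information_ge w (c : R) : 0 < c ->
  (\int[leb]_(s in `[a, b]) (lam s w)%:E <= (c * (b - a))%:E)%E ->
  mu ^+ 2 * ((b - a) / c) <= Q w.
Proof.
move=> c0 hX; rewrite /Q /baseline_information ler_wpM2l ?sqr_ge0//.
have mlw : measurable_fun setT (lam ^~ w).
  exact: (measurableT_comp mlam (pair1_measurable w)).
have lebab : leb `[a, b] = (b - a)%:E.
  by rewrite lebesgue_measure_itv/= lte_fin ab.
have ilam : leb.-integrable `[a, b] (EFin \o lam ^~ w).
  apply/integrableP; split; first exact/measurable_EFinP/measurable_funTS.
  under eq_integral do rewrite /= ger0_norm ?(ltW (lam_gt0 _ _))//.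
  exact: le_lt_trans hX (ltry _).
have iinv : leb.-integrable `[a, b] (EFin \o (fun s => (lam s w)^-1)).
  apply: measurable_bounded_integrable => //.
  - by rewrite /= lebab ltry.
  - apply: measurable_funTS.
    rewrite (_ : (fun s => _) = (fun s => powR (lam s w) (-1))).
      exact: (measurableT_comp (@measurable_powR R (-1)) mlw).
    by apply/funext => s; rewrite powR_inv1// ltW.
  - exists mu^-1; split; rewrite ?num_real// => y muy s _.
    apply: le_trans (ltW muy); rewrite ger0_norm; last by rewrite invr_ge0 ltW.
    by rewrite lef_pV2 ?posrE// hawkes_intensity_ge.
have icst (k : R) : leb.-integrable `[a, b] (EFin \o (fun=> k)).
  exact: (continuous_itv_integrable a b (fun x => cvg_cst k)).
have iscal : leb.-integrable `[a, b] (EFin \o (fun s => (c ^+ 2)^-1 * lam s w)).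
  exact: (integrableZl _ (c ^+ 2)^-1 ilam).
have h : \int[leb]_(s in `[a, b]) (2 / c - (c ^+ 2)^-1 * lam s w) <=
    \int[leb]_(s in `[a, b]) (lam s w)^-1.
  apply: le_Rintegral => //; first exact: (integrableB _ (icst (2 / c)) iscal).
  move=> s _; move: (lam s w) (lam_gt0 s w) => l l0.
  rewrite -subr_ge0.
  have -> : l^-1 - (2 / c - (c ^+ 2)^-1 * l) = (l - c) ^+ 2 / (c ^+ 2 * l).
    by field; rewrite !gt_eqF.
  by rewrite divr_ge0 ?sqr_ge0// mulr_ge0 ?sqr_ge0// ltW.
apply: le_trans h; rewrite RintegralB// Rintegral_cst// [X in fine X]lebab/= RintegralZl//.
have : \int[leb]_(s in `[a, b]) lam s w <= c * (b - a).
  rewrite -lee_fin /Rintegral fineK//; exact: integrable_fin_num.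
move: (\int[leb]_(s in `[a, b]) lam s w) => I hI.
have -> : (b - a) / c = 2 / c * (b - a) - (c ^+ 2)^-1 * (c * (b - a)).
  by field; rewrite gt_eqF.
by rewrite lerB// ler_wpM2l// invr_ge0 sqr_ge0.
Qed.

Let measurable_information (K : R) :
  measurable [set w | Q w < K] /\ measurable [set w | K <= Q w].
Proof.
have mQ := measurable_baseline_information spp mu_gt0 rho_ge0 g_cont g_ge0 a b.
split.
- rewrite (_ : [set w | _] = Q @^-1` `]-oo, K[).
    by rewrite -[X in measurable X]setTI; exact: mQ.
  by apply/seteqP; split => w /=; rewrite in_itv.
- rewrite (_ : [set w | _] = Q @^-1` `[K, +oo[).
    by rewrite -[X in measurable X]setTI; exact: mQ.
  by apply/seteqP; split => w /=; rewrite in_itv/= andbT.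
Qed.

(** An integral of the intensity below [c * (b - a)] gives the information the
    lower bound [mu ^ 2 * (b - a) / c]; [c] is chosen to make this bound [K]. *)
Lemma proba_information_lt (K : R) : 0 < K ->
  (P [set w | (Q w < K)%R] <= (K / (mu * (1 - rho) * (b - a)))%:E)%E.
Proof.
move=> K0; pose c := mu ^+ 2 * (b - a) / K.
have c0 : 0 < c by rewrite divr_gt0// mulr_gt0// exprn_gt0.
have cL : 0 < c * (b - a) by exact: mulr_gt0.
pose X w := (\int[leb]_(s in `[a, b]) (lam s w)%:E)%E.
have X0 w : (0 <= X w)%E by apply: integral_ge0 => s _; rewrite lee_fin ltW.
have mX : measurable_fun setT X.
  apply: (@measurable_integral_upto _ _ R (fun p : Omega * R => lam p.2 p.1) a (fun=> b)) => //.
  by move=> z; exact: ltW.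
pose B := [set w | ((c * (b - a))%:E <= `|X w|)%E].
have mB : measurable B.
  by rewrite -[B]setTI; apply: measurable_lee => //; exact: measurableT_comp.
have hB : ((c * (b - a))%:E * P B <= ((b - a) * (mu / (1 - rho)))%:E)%E.
  have := le_integral_abse P measurableT mX cL; rewrite setTI => /le_trans; apply.
  under eq_integral do rewrite gee0_abs//.
  exact: (mean_integral_intensity_le spp si mg mu_gt0 rho_ge0 rho_lt1 (fun s _ => g_ge0 s)
    g_le g_mass a_gt0 (ltW ab)).
have [mQ _] := measurable_information K.
apply: (@le_trans _ _ (P B)).
  apply: le_measure; rewrite ?inE// => w /= QK; rewrite /B/= gee0_abs//.
  rewrite leNgt; apply/negP => /ltW /(information_ge c0).
  have -> : mu ^+ 2 * ((b - a) / c) = K.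
    by rewrite /c; field; rewrite !gt_eqF.
  by rewrite leNgt QK.
move: hB; rewrite -[P B]fineK ?fin_num_measure// -EFinM !lee_fin => hB.
have r1 : 0 < 1 - rho by rewrite subr_gt0.
rewrite -(ler_pM2l cL); apply: le_trans hB _.
rewrite le_eqVlt; apply/orP; left; apply/eqP; rewrite /c.
by field; rewrite !gt_eqF.
Qed.

(** The smaller deviation [e] keeps the two competing baselines
    [mu + e * mu] and [mu - e * mu] in the range where the square root of the
    likelihood ratio is controlled. *)
Lemma proba_mle_deviation (mh : Omega -> R) (eps e K : R) :
  (forall w, is_mle rho g t a b w (mh w)) ->
  0 < e -> e <= eps -> e <= 2^-1 -> 0 < K ->
  (P [set w | (eps < `|mh w / mu - 1|)%R] <=
   (K / (mu * (1 - rho) * (b - a)) + 2 * expR (- (e ^+ 2 / 18 * K)))%:E)%E.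
Proof.
move=> mle e0 eeps e2 K0.
have [mlt mge] := measurable_information K.
pose A v := [set w | (ell w mu < ell w (mu + v))%E] `&` [set w | (K <= Q w)%R].
have me0 : 0 < e * mu by exact: mulr_gt0.
have memu : e * mu <= mu / 2 by rewrite mulrC ler_wpM2l// ltW.
have mA v : `|v| <= mu / 2 -> measurable (A v).
  rewrite ler_norml => /andP[v1 v2]; apply: measurableI => //.
  by apply: measurable_loglik_lt => //; move: mu_gt0 v1 v2; lra.
have PA v : `|v| = e * mu -> (P (A v) <= (expR (- (e ^+ 2 / 18 * K)))%:E)%E.
  move=> ve; have -> : e ^+ 2 = v ^+ 2 / mu ^+ 2.
    by rewrite -(real_normK (num_real v)) ve exprMn mulfK// gt_eqF// exprn_gt0.
  apply: proba_likelihood_exceeds => //; last by rewrite ve.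
  by rewrite -normr_gt0 ve.
have nv1 : `|e * mu| = e * mu by rewrite gtr0_norm.
have nv2 : `|- (e * mu)| = e * mu by rewrite normrN gtr0_norm.
have mm : measurable [set w | eps < `|mh w / mu - 1|].
  rewrite (_ : [set w | _] = (fun w => `|mh w / mu - 1|) @^-1` `]eps, +oo[).
    rewrite -[X in measurable X]setTI.
    have mf : measurable_fun setT (fun w => `|mh w / mu - 1|).
      apply: measurableT_comp => //; apply: measurable_funB => //.
      by apply: measurable_funM => //; exact: (measurable_mle spp mg rho_ge0 g_ge0 ab mle).
    exact: mf.
  by apply/seteqP; split => w /=; rewrite in_itv/= andbT.
have mA1 : measurable (A (e * mu)) by apply: mA; rewrite nv1.
have mA2 : measurable (A (- (e * mu))) by apply: mA; rewrite nv2.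
apply: (@le_trans _ _ (P ([set w | Q w < K] `|` (A (e * mu) `|` A (- (e * mu)))))).
  apply: le_measure; rewrite ?inE//.
    by apply: measurableU => //; exact: measurableU.
  move=> w /= dev; have [KQ|?] := leP K (Q w); last by left.
  right; move: dev; rewrite lter_normr => /orP[dev|dev].
    left; split => //=.
    apply: (mle_gt spp rho_ge0 g_ge0 ab (mle w)); first exact: ltW.
      by rewrite ltrDl.
    have : e < mh w / mu - 1 by exact: le_lt_trans dev.
    by rewrite ltrBrDr ltr_pdivlMr//; lra.
  right; split => //=.
  apply: (mle_lt spp rho_ge0 g_ge0 ab (mle w)).
    have : e < - (mh w / mu - 1) by exact: le_lt_trans dev.
    rewrite opprB ltrBrDr -ltrBrDl ltr_pdivrMr//; lra.
  by rewrite gtrDl oppr_lt0.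
apply: le_trans (measureU2 _ _ _) _ => //; first exact: measurableU.
rewrite EFinD leeD ?proba_information_lt//.
apply: le_trans (measureU2 _ _ _) _ => //.
by rewrite mulr_natl mulr2n EFinD leeD// PA.
Qed.

End HawkesBounds.

(** * The power-law kernel *)

Section Kernel.
Context (R : realType).
Variable gamma : R.
Hypotheses (gamma_gt0 : 0 < gamma).

(** The power function is discontinuous where its base vanishes, at [s = -1]. Freezing the
    kernel at its value in 0 on negative arguments makes it continuous
    everywhere, and only nonnegative arguments occur in the intensity and in the
    likelihood. *)
Definition flat_kernel (s : R) : R := hawkes_kernel gamma (Num.max 0 s).

Lemma flat_kernelE s : 0 <= s -> flat_kernel s = hawkes_kernel gamma s.
Proof. by move=> s0; rewrite /flat_kernel (max_idPr s0). Qed.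

Lemma flat_kernel_ge0 s : 0 <= flat_kernel s.
Proof. by rewrite mulr_ge0 ?powR_ge0// ltW. Qed.

Let is_derive_powR_affine (c p x : R) : 0 < c - x ->
  is_derive x 1 (fun s => powR (c - s) p) (- (p * powR (c - x) (p - 1))).
Proof.
move=> cx; have dA : is_derive x 1 (fun s : R => c - s) (-1).
  by rewrite -[X in is_derive _ _ _ X]add0r; exact: is_deriveB.
have := @is_derive1_comp R (@powR R ^~ p) (fun s : R => c - s) _ _ _ (is_derive1_powR p cx) dA.
by rewrite mulrN1.
Qed.

Let continuous_powR (p x : R) : 0 < x -> {for x, continuous (fun s => powR s p)}.
Proof.
move=> x0; apply/differentiable_continuous/derivable1_diffP.
by have := is_derive1_powR p x0 => ?; exact: ex_derive.
Qed.

Lemma flat_kernel_continuous : continuous flat_kernel.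
Proof.
move=> s.
have h1 : {for s, continuous (fun s : R => 1 + Num.max 0 s)}.
  apply: cvgD; first exact: cvg_cst.
  by apply: (@continuous_max _ _ (fun=> 0) id); [exact: cvg_cst|exact: cvg_id].
have h2 : {for 1 + Num.max 0 s, continuous (fun x : R => powR x (- 1 - gamma))}.
  by apply: continuous_powR; rewrite ltr_pwDl// le_max lexx.
apply: (@cvgM _ _ _ _ (fun=> gamma)); first exact: cvg_cst.
exact: (continuous_comp h1 h2).
Qed.

Lemma flat_kernel_le s : flat_kernel s <= gamma.
Proof.
rewrite /flat_kernel /hawkes_kernel -[leRHS]mulr1 ler_wpM2l ?(ltW gamma_gt0)//.
rewrite -[leRHS](powRr0 (1 + Num.max 0 s)) ler_powR//.
  by rewrite lerDl le_max lexx.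
by rewrite subr_le0 (le_trans _ (ltW gamma_gt0))// lerN10.
Qed.

(** The function [s |-> (1 + S - s) `^ (- gamma)] is a primitive; it is 1 at [S]. *)
Lemma flat_kernel_mass (S : R) : 0 < S ->
  (\int[lebesgue_measure]_(s in `]0%R, S[) (flat_kernel (S - s))%:E <= 1)%E.
Proof.
move=> S0; have mg : measurable_fun setT (fun s : R => flat_kernel (S - s)).
  apply: (measurableT_comp (continuous_measurable_fun flat_kernel_continuous)).
  exact: measurable_funB.
apply: (@le_trans _ _
   (\int[lebesgue_measure]_(s in `[0%R, S]) (flat_kernel (S - s))%:E)%E).
  apply: ge0_subset_integral => //.
  - exact/measurable_funTS/measurable_EFinP.
  - by move=> s _; rewrite lee_fin flat_kernel_ge0.
  - exact: subset_itv_oo_cc.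
pose F (s : R) := powR (1 + S - s) (- gamma).
have -> : (\int[lebesgue_measure]_(s in `[0%R, S]) (flat_kernel (S - s))%:E =
    (F S - F 0)%:E)%E.
  apply: integral_is_derive => //.
    apply: continuous_subspaceT => s.
    apply: (@continuous_comp _ _ _ (fun s : R => S - s) flat_kernel).
      by apply: cvgB; [exact: cvg_cst|exact: cvg_id].
    exact: flat_kernel_continuous.
  move=> s /andP[s0 sS].
  have h : 0 < 1 + S - s by move: s0 sS; lra.
  rewrite flat_kernelE ?subr_ge0// /hawkes_kernel.
  have := is_derive_powR_affine (- gamma) h.
  by rewrite mulNr opprK -addrA [- gamma - 1]addrC.
by rewrite /F addrK powR1 lee_fin gerBl; exact: powR_ge0.
Qed.

End Kernel.

Section KernelOnHalfLine.
Context (d : measure_display) (Omega : measurableType d) (R : realType).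
Variables (t : nat -> Omega -> \bar R) (g h : R -> R).
Hypothesis spp : simple_point_process t.
Hypothesis gh : forall s, 0 <= s -> g s = h s.

Lemma hawkes_intensity_eq_kernel mu rho :
  hawkes_intensity mu rho g t = hawkes_intensity mu rho h t.
Proof.
apply/funext => s; apply/funext => w; congr (_ + _ * _).
apply: eq_fsbigr => j; rewrite inE /= => tjs; apply: gh.
have := point_gt0 spp j w; move: tjs; case: (t j w) => // r.
by rewrite lte_fin subr_ge0 => /ltW.
Qed.

Lemma log_likelihood_eq_kernel rho a b w :
  log_likelihood rho g t a b w = log_likelihood rho h t a b w.
Proof.
apply/funext => m; congr (_ - _)%E.
apply: eq_fsbigr => i; rewrite inE /= => /andP[_ ib].
suff -> : excitation rho g t i w = excitation rho h t i w by [].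
congr (_ * _); apply: eq_big_nat => j /andP[_ ji]; apply: gh.
have ti : (t i w < +oo)%E by rewrite (le_lt_trans ib)// ltry.
have tij := point_le spp w (ltnW ji).
have := point_gt0 spp j w; move: tij ti; case: (t i w) => // [r|]; case: (t j w) => // s.
by rewrite lee_fin subr_ge0.
Qed.

End KernelOnHalfLine.

(** * Upper and lower limits *)

Section Limits.
Context (R : realType).

Lemma limf_einf_ge (f : R -> \bar R) (F : set_system R) (c : \bar R) :
  (\forall x \near F, c <= f x)%E -> (c <= limf_einf f F)%E.
Proof.
move=> h; rewrite limf_einfE; apply: le_trans (ereal_sup_ubound _); last first.
  by exists [set x | (c <= f x)%E]; [exact: h|reflexivity].
by apply: le_ereal_inf_tmp => _ [x /= cx <-].
Qed.

Lemma limf_esup_le (f : R -> \bar R) (F : set_system R) (c : \bar R) :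
  (\forall x \near F, f x <= c)%E -> (limf_esup f F <= c)%E.
Proof.
move=> h; rewrite limf_esupE; apply: le_trans (ereal_inf_lbound _) _.
  by exists [set x | (f x <= c)%E]; [exact: h|reflexivity].
by apply: ge_ereal_sup => _ [x /= cx <-].
Qed.

Lemma limf_einf_le (f : R -> \bar R) (F : set_system R) {FF : ProperFilter F}
  (c : \bar R) : (\forall x \near F, f x <= c)%E -> (limf_einf f F <= c)%E.
Proof.
move=> h; rewrite limf_einfE; apply: ge_ereal_sup => _ [V FV <-].
have [x [Vx xc]] := filter_ex (filterI FV h).
by apply: le_trans xc; apply: ereal_inf_lbound; exists x.
Qed.

Lemma cvg_scaled_inv_sqrt (c : R) : c / Num.sqrt H @[H --> +oo] --> 0.
Proof.
rewrite -[X in _ --> X](mulr0 c); apply: cvgM; first exact: cvg_cst.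
apply/gtr0_cvgV0.
  near=> H; rewrite sqrtr_gt0; near: H; exact: nbhs_pinfty_gt.
apply/cvgryPge => A; near=> H.
by rewrite (le_trans (ler_norm A))// -sqrtr_sqr ler_wsqrtr//.
Unshelve. all: by end_near. Qed.

End Limits.

(** * The nearly unstable scaling *)

Section NearlyUnstable.
Context (R : realType) (lamstar mustar gamma T : R).
Hypotheses (mustar_gt0 : 0 < mustar) (gamma_gt0 : 0 < gamma) (T_gt0 : 0 < T).
Let mu := baseline mustar gamma T.
Let rho := branching lamstar gamma T.

Let mu_gt0 : 0 < mu. Proof. by rewrite mulr_gt0// powR_gt0. Qed.

(** The exponents [gamma - 1], [- gamma] and 1 of the baseline, of the distance to
   criticality and of the window length add up to 0. *)
Let information_scale (M H : R) :
  mu * (1 - rho) * ((M + H) * T - M * T) = mustar * lamstar * H.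
Proof.
have e : powR T (gamma - 1) * powR T (- gamma) * T = 1.
  rewrite -powRD; last by apply/implyP => _; rewrite gt_eqF.
  rewrite addrAC subrr add0r powR_inv1 ?ltW// mulVf// gt_eqF//.
rewrite /mu /rho /baseline /branching.
rewrite (_ : _ * _ * (_ - _) = mustar * lamstar * H *
  (powR T (gamma - 1) * powR T (- gamma) * T)); last by ring.
by rewrite e mulr1.
Qed.

Context (d : measure_display) (Omega : measurableType d) (P : probability Omega R).
Variable t : nat -> Omega -> \bar R.
Hypothesis rho01 : 0 < rho < 1.
Hypothesis hawkes : linear_hawkes P mu rho (hawkes_kernel gamma) t.
Variables M H : R.
Hypotheses (M_gt0 : 0 < M) (H_gt0 : 0 < H).
Let a := M * T.
Let b := (M + H) * T.

Let a_gt0 : 0 < a. Proof. exact: mulr_gt0. Qed.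
Let ab : a < b. Proof. by rewrite /a /b ltr_pM2r// ltrDl. Qed.
Let rho_ge0 : 0 <= rho. Proof. by case/andP: rho01 => /ltW. Qed.
Let rho_lt1 : rho < 1. Proof. by case/andP: rho01. Qed.

Let kernelE (s : R) : 0 <= s -> hawkes_kernel gamma s = flat_kernel gamma s.
Proof. by move=> s0; rewrite flat_kernelE. Qed.

Let Q := baseline_information mu rho (hawkes_kernel gamma) t a b.

Let spp : simple_point_process t. Proof. by case: hawkes. Qed.

Let intensityE : hawkes_intensity mu rho (hawkes_kernel gamma) t =
  hawkes_intensity mu rho (flat_kernel gamma) t.
Proof. exact: hawkes_intensity_eq_kernel. Qed.

Let si : stochastic_intensity P t (hawkes_intensity mu rho (flat_kernel gamma) t).
Proof. by rewrite -intensityE; case: hawkes. Qed.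

Let QE : Q = baseline_information mu rho (flat_kernel gamma) t a b.
Proof.
by apply/funext => w; rewrite /Q /baseline_information intensityE.
Qed.

Let gc := @flat_kernel_continuous R gamma.
Let gg := flat_kernel_ge0 gamma_gt0.

Lemma proba_information_ge (K : R) : 0 < K ->
  ((1 - K / (mustar * lamstar * H))%:E <= P [set w | (K <= Q w)%R] <= 1)%E.
Proof.
move=> K0; rewrite QE.
have mQ := measurable_baseline_information spp mu_gt0 rho_ge0 gc gg a b.
have mlt : measurable [set w |
    (baseline_information mu rho (flat_kernel gamma) t a b w < K)%R].
  rewrite (_ : [set w | _] =
      baseline_information mu rho (flat_kernel gamma) t a b @^-1` `]-oo, K[).
    by rewrite -[X in measurable X]setTI; exact: mQ.
  by apply/seteqP; split => w /=; rewrite in_itv.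
have := proba_information_lt spp si mu_gt0 rho_ge0 rho_lt1 gc gg
  (fun s _ => flat_kernel_le gamma_gt0 s) (flat_kernel_mass gamma_gt0) a_gt0 ab K0.
rewrite information_scale => hlt.
rewrite (_ : [set w | (K <= _)%R] = ~` [set w |
    (baseline_information mu rho (flat_kernel gamma) t a b w < K)%R]).
  rewrite (probability_le1 P (measurableC mlt)) andbT.
  rewrite (probability_setC P mlt) EFinB.
  exact: leeB (lexx _) hlt.
by apply/seteqP; split => w /=; rewrite leNgt => /negP.
Qed.

Lemma proba_mle_relative_error (mh : Omega -> R) (eps e K : R) :
  (forall w, is_mle rho (hawkes_kernel gamma) t a b w (mh w)) ->
  0 < e -> e <= eps -> e <= 2^-1 -> 0 < K ->
  (P [set w | (eps < `|mh w / mu - 1|)%R] <=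
   (K / (mustar * lamstar * H) + 2 * expR (- (e ^+ 2 / 18 * K)))%:E)%E.
Proof.
move=> mle e0 eeps e2 K0.
have mle' w : is_mle rho (flat_kernel gamma) t a b w (mh w).
  by have := mle w; rewrite /is_mle (log_likelihood_eq_kernel spp kernelE).
have := proba_mle_deviation spp si mu_gt0 rho_ge0 rho_lt1 gc gg
  (fun s _ => flat_kernel_le gamma_gt0 s) (flat_kernel_mass gamma_gt0) a_gt0 ab
  mle' e0 eeps e2 K0.
by rewrite information_scale.
Qed.

End NearlyUnstable.

(** The branching ratio is positive as soon as [T] exceeds
    [lamstar `^ gamma^-1]. *)
Lemma branching_near_critical (R : realType) (lamstar gamma : R) :
  0 < lamstar -> 0 < gamma ->
  \forall T \near +oo, 0 < T /\ 0 < branching lamstar gamma T < 1.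
Proof.
move=> l0 g0; near=> T.
have T0 : 0 < T by [].
split => //; rewrite /branching subr_gt0 gtrBl mulr_gt0 ?powR_gt0// andbT.
rewrite powRN ltr_pdivrMr ?powR_gt0// mul1r.
rewrite -[ltLHS](powRr1 (ltW l0)) -[X in powR _ X](@mulVf _ gamma) ?gt_eqF//.
by rewrite powRrM gt0_ltr_powR ?nnegrE ?powR_ge0// ltW.
Unshelve. all: by end_near. Qed.

(** * Information and consistency *)

Theorem theorem5p9 (R : realType) (lamstar mustar gamma : R)
  (hlam : 0 < lamstar) (hmu : 0 < mustar)
  (hgamma : 2^-1 < gamma < 1)
  (d : R -> measure_display) (Omega : forall T : R, measurableType (d T))
  (P : forall T : R, probability (Omega T) R)
  (t : forall T : R, nat -> Omega T -> \bar R)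
  (hawkes : forall T : R, 0 < T -> 0 < branching lamstar gamma T < 1 ->
     linear_hawkes (P T) (baseline mustar gamma T) (branching lamstar gamma T)
       (hawkes_kernel gamma) (@t T))
  (muhat : forall T M H : R, Omega T -> R)
  (mle : forall T M H : R, 0 < T -> 0 < branching lamstar gamma T < 1 ->
     0 < M -> 0 < H -> forall w : Omega T,
     is_mle (branching lamstar gamma T) (hawkes_kernel gamma) (@t T)
       (M * T) ((M + H) * T) w (muhat T M H w)) :
  (forall K : R, 0 < K ->
     limf_einf (fun M : R =>
       limf_einf (fun T : R =>
         P T [set w | K <= baseline_information (baseline mustar gamma T)
                             (branching lamstar gamma T) (hawkes_kernel gamma)
                             (@t T) (M * T) ((M + H) * T) w])
         +oo)
       +oo @[H --> +oo] --> 1%E)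
  /\
  (forall eps : R, 0 < eps ->
     limf_esup (fun M : R =>
       limf_esup (fun T : R =>
         P T [set w | eps < `|muhat T M H w / baseline mustar gamma T - 1|])
         +oo)
       +oo @[H --> +oo] --> 0%E).
Proof.
have g0 : 0 < gamma by case/andP: hgamma => + _; apply: lt_trans; rewrite invr_gt0.
have nearT := branching_near_critical hlam g0.
pose m := mustar * lamstar.
have m0 : 0 < m by exact: mulr_gt0.
split => [K K0|eps eps0].
- apply: (@squeeze_cvge _ _ _ _ (fun H => (1 - K / m / Num.sqrt H)%:E) _ (fun=> 1%E)).
  + near=> H; have H0 : 0 < H by [].
    have H1 : 1 <= H by near: H; exact: nbhs_pinfty_ge.
    have bounds M T : 0 < M -> 0 < T /\ 0 < branching lamstar gamma T < 1 ->
        ((1 - K / m / Num.sqrt H)%:E <=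
         P T [set w | (K <= baseline_information (baseline mustar gamma T)
           (branching lamstar gamma T) (hawkes_kernel gamma) (@t T)
           (M * T) ((M + H) * T) w)%R] <= 1)%E.
      move=> M0 [T0 b01].
      have /andP[h ->] := proba_information_ge hmu g0 T0 b01 (hawkes T T0 b01) M0 H0 K0.
      rewrite andbT; apply: le_trans h.
      rewrite lee_fin lerD2l lerN2 -/m invfM mulrA.
      apply: ler_wpM2l; first exact: divr_ge0 (ltW K0) (ltW m0).
      rewrite lef_pV2 ?posrE ?sqrtr_gt0// -[leRHS]gtr0_norm// -sqrtr_sqr.
      by rewrite ler_wsqrtr// expr2 ler_peMl// ltW.
    apply/andP; split.
      apply: limf_einf_ge; near=> M; apply: limf_einf_ge; near=> T.
      have M0 : 0 < M by [].
      have hT : 0 < T /\ 0 < branching lamstar gamma T < 1 by near: T.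
      by case/andP: (bounds M T M0 hT).
    apply: limf_einf_le; near=> M; apply: limf_einf_le; near=> T.
    have M0 : 0 < M by [].
    have hT : 0 < T /\ 0 < branching lamstar gamma T < 1 by near: T.
    by case/andP: (bounds M T M0 hT).
  + apply: cvg_EFin; first exact: nearW.
    rewrite /= -[X in _ --> X]subr0; apply: cvgB; first exact: cvg_cst.
    exact: cvg_scaled_inv_sqrt.
  + exact: cvg_cst.
- pose e := Num.min eps 2^-1.
  have e0 : 0 < e by rewrite /e lt_min eps0 invr_gt0/=.
  (* The threshold on the information is [Num.sqrt H]; the exponential term is
     bounded by [2 / x] with [x = e ^+ 2 / 18 * Num.sqrt H], hence 36 = 2 * 18. *)
  pose c := m^-1 + 36 / e ^+ 2.
  apply: (@squeeze_cvge _ _ _ _ (fun=> 0%E) _ (fun H => (c / Num.sqrt H)%:E)).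
  + near=> H; have H0 : 0 < H by [].
    have s0 : 0 < Num.sqrt H by rewrite sqrtr_gt0.
    apply/andP; split.
      apply: limf_esup_ge0; first exact: filter_not_empty.
      move=> M; apply: limf_esup_ge0; first exact: filter_not_empty.
      by move=> T; exact: measure_ge0.
    apply: limf_esup_le; near=> M; apply: limf_esup_le; near=> T.
    have M0 : 0 < M by [].
    have [T0 b01] : 0 < T /\ 0 < branching lamstar gamma T < 1 by near: T.
    apply: le_trans (proba_mle_relative_error hmu g0 T0 b01 (hawkes T T0 b01) M0 H0
      (mle T M H T0 b01 M0 H0) e0 _ _ s0) _.
    * by rewrite ge_min lexx.
    * by rewrite ge_min lexx orbT.
    rewrite lee_fin /c [leRHS]mulrDl; apply: lerD.
      rewrite -/m -[X in _ / (m * X)](sqr_sqrtr (ltW H0)) expr2.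
      by rewrite le_eqVlt; apply/orP; left; apply/eqP; field; rewrite !gt_eqF.
    set x := e ^+ 2 / 18 * Num.sqrt H.
    have x0 : 0 < x by rewrite mulr_gt0// divr_gt0// exprn_gt0.
    have -> : 36 / e ^+ 2 / Num.sqrt H = 2 * x^-1.
      by rewrite /x; field; rewrite !gt_eqF.
    rewrite expRN ler_wpM2l// lef_pV2 ?posrE ?expR_gt0//.
    by apply: le_trans (expR_ge1Dx x); rewrite lerDr.
  + exact: cvg_cst.
  + apply: cvg_EFin; first exact: nearW.
    exact: cvg_scaled_inv_sqrt.
Unshelve. all: by end_near. Qed.
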